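(* Let $(\mathbb W,\mathbb U,\widehat{\mathbb V},\mathbb F)$ be a braided multiplicative unitary, with $\mathbb W\in\mathcal U(\mathcal H\otimes\mathcal H)$, $\mathbb U\in\mathcal U(\mathcal L\otimes\mathcal H)$, $\widehat{\mathbb V}\in\mathcal U(\mathcal H\otimes\mathcal L)$, $\mathbb F\in\mathcal U(\mathcal L\otimes\mathcal L)$. The representation $$\rho=(\mathcal H\otimes\mathcal L,\ \mathbb W_{13}\mathbb U_{23},\ \mathbb F_{23})=(\mathcal H,\mathbb W,1)\otimes(\mathcal L,\mathbb U,\mathbb F)$$ is a natural right absorber for the tensor category $\mathrm{Rep}(\mathbb W,\mathbb U,\widehat{\mathbb V},\mathbb F)$; that is, there are unitary arrows $A^x\colon x\otimes\rho\to\tau(x)\otimes\rho$, for all objects $x$, that together with $\rho$ form a natural right absorber.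
   Context: Leg numbering notation is used throughout; $\mathcal U(\cdot)$ denotes the unitary group. A multiplicative unitary is $\mathbb W\in\mathcal U(\mathcal H\otimes\mathcal H)$ with $\mathbb W_{23}\mathbb W_{12}=\mathbb W_{12}\mathbb W_{13}\mathbb W_{23}$. A right representation of $\mathbb W$ on $\mathcal K$ is $\mathbb S\in\mathcal U(\mathcal K\otimes\mathcal H)$ with $\mathbb W_{23}\mathbb S_{12}=\mathbb S_{12}\mathbb S_{13}\mathbb W_{23}$. A braided multiplicative unitary over $\mathbb W$ consists of a multiplicative unitary $\mathbb W\in\mathcal U(\mathcal H\otimes\mathcal H)$, a Hilbert space $\mathcal L$ and unitaries $\mathbb U\in\mathcal U(\mathcal L\otimes\mathcal H)$, $\widehat{\mathbb V}\in\mathcal U(\mathcal H\otimes\mathcal L)$, $\mathbb F\in\mathcal U(\mathcal L\otimes\mathcal L)$ such that: $\mathbb W_{23}\mathbb U_{12}=\mathbb U_{12}\mathbb U_{13}\mathbb W_{23}$; $\widehat{\mathbb V}_{23}\mathbb W_{12}=\mathbb W_{12}\widehat{\mathbb V}_{13}\widehat{\mathbb V}_{23}$; $\widehat{\mathbb V}_{12}\mathbb W_{13}\mathbb U_{23}=\mathbb U_{23}\mathbb W_{13}\widehat{\mathbb V}_{12}$ in $\mathcal U(\mathcal H\otimes\mathcal L\otimes\mathcal H)$; $\mathbb U_{13}\mathbb U_{23}\mathbb F_{12}=\mathbb F_{12}\mathbb U_{13}\mathbb U_{23}$ in $\mathcal U(\mathcal L\otimes\mathcal L\otimes\mathcal H)$;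 $\widehat{\mathbb V}_{13}\widehat{\mathbb V}_{12}\mathbb F_{23}=\mathbb F_{23}\widehat{\mathbb V}_{13}\widehat{\mathbb V}_{12}$ in $\mathcal U(\mathcal H\otimes\mathcal L\otimes\mathcal L)$; and $\mathbb F_{23}\mathbb F_{12}=\mathbb F_{12}(c_{\mathcal L,\mathcal L})_{23}\mathbb F_{12}(c_{\mathcal L,\mathcal L}^{-1})_{23}\mathbb F_{23}$ in $\mathcal U(\mathcal L\otimes\mathcal L\otimes\mathcal L)$. Here, for a right representation $(\mathcal K,\mathbb S)$ of $\mathbb W$, $c_{\mathcal L,\mathcal K}\colon\mathcal L\otimes\mathcal K\to\mathcal K\otimes\mathcal L$ is $c_{\mathcal L,\mathcal K}=Z\Sigma$, where $\Sigma$ is the flip and $Z\in\mathcal U(\mathcal K\otimes\mathcal L)$ is the unique unitary with $Z_{13}=\widehat{\mathbb V}_{23}\mathbb S_{12}^*\widehat{\mathbb V}_{23}^*\mathbb S_{12}$ in $\mathcal U(\mathcal K\otimes\mathcal H\otimes\mathcal L)$; existence of $Z$ for all right representations is part of the standing setup (it is automatic if $\mathbb W$ is manageable). For $c_{\mathcal L,\mathcal L}$ use $\mathbb S=\mathbb U$. $\mathrm{Rep}(\mathbb W,\mathbb U,\widehat{\mathbb V},\mathbb F)$: objects are triples $(\mathcal K,\mathbb S,\mathbb T)$ with $\mathbb S\in\mathcal U(\mathcal K\otimes\mathcal H)$ a right representation of $\mathbb W$ and $\mathbb T\in\mathcal U(\mathcal K\otimes\mathcal L)$ with $\mathbb S_{13}\mathbb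 U_{23}\mathbb T_{12}=\mathbb T_{12}\mathbb S_{13}\mathbb U_{23}$ and $\mathbb F_{23}\mathbb T_{12}=\mathbb T_{12}(c_{\mathcal L,\mathcal L})_{23}\mathbb T_{12}(c_{\mathcal L,\mathcal L}^{-1})_{23}\mathbb F_{23}$. Arrows are bounded operators $a$ with $a_1\mathbb S^1=\mathbb S^2a_1$, $a_1\mathbb T^1=\mathbb T^2a_1$. The tensor product of $(\mathcal K^i,\mathbb S^i,\mathbb T^i)$, $i=1,2$, is $(\mathcal K^1\otimes\mathcal K^2,\ \mathbb S^1_{13}\mathbb S^2_{23},\ (c_{\mathcal L,\mathcal K^2})_{23}\mathbb T^1_{12}(c_{\mathcal L,\mathcal K^2}^{-1})_{23}\mathbb T^2_{23})$; the unit is $(\mathbb C,1,1)$, with associators and unit maps of Hilbert spaces. For a Hilbert space $\mathcal K$, $\tau(\mathcal K):=(\mathcal K,1,1)$, and for an object $x=(\mathcal K,\mathbb S,\mathbb T)$, $\tau(x):=\tau(\mathcal K)$. A natural right absorber in this tensor category $\mathcal C$ is an object $\rho$ with unitary arrows $A^x\colon x\otimes\rho\to\tau(x)\otimes\rho$ for all objects $x$ such that (i) $A^{x_2}(a\otimes\mathrm{id}_\rho)=(a\otimes\mathrm{id}_\rho)A^{x_1}$ for every arrow $a\colon x_1\to x_2$; (ii) $A^{x_1\otimes x_2}=A^{x_1}_{13}A^{x_2}_{23}$ for all objects $x_1,x_2$ (legs numbered with respect to $x_1\otimes x_2\otimes\rho$; here $A^{x_1}_{13}$ is an arrow $x_1\otimes\tau(x_2)\otimes\rho\to\tau(x_1)\otimes\tau(x_2)\otimes\rho$).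 *)

(* Defs.v *)
From HB Require Import structures.
From mathcomp Require Import all_boot all_order all_algebra.
From mathcomp Require Import complex ring.
From mathcomp Require Import boolp classical_sets functions reals topology normedtype.

Set Implicit Arguments.
Unset Strict Implicit.
Unset Printing Implicit Defensive.
Import Order.TTheory GRing.Theory Num.Theory.
Import numFieldNormedType.Exports.
Local Open Scope classical_set_scope.
Local Open Scope ring_scope.

(* A dot product is linear in its first argument and conjugate-linear in its
   second one. *)
HB.mixin Record CompleteNormedModule_isHilbert (R : realType) H
    & CompleteNormedModule R[i] H := {
  inner : {dot H for @Num.conj R[i]};
  sqr_normE : forall x : H, `|x| ^+ 2 = inner x x
}.

#[short(type="hilbertType")]
HB.structure Definition Hilbert (R : realType) :=
  {H of CompleteNormedModule R[i] H & CompleteNormedModule_isHilbert R H}.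

Section ComplexSequences.
Variable R : realType.
Local Notation C := R[i].

Definition seq_lim (a : nat -> C) (l : C) :=
  forall e, 0 < e -> exists N, forall n, (N <= n)%N -> `|a n - l| < e.

Definition seq_cauchy (a : nat -> C) :=
  forall e, 0 < e -> exists N, forall m n, (N <= m)%N -> (N <= n)%N ->
    `|a m - a n| < e.

Lemma invn_lt (e : C) : 0 < e -> exists N, forall n, (N <= n)%N -> n.+1%:R^-1 < e.
Proof.
move=> e0; have er : e = (complex.Re e)%:C%C by rewrite RRe_real// gtr0_real.
have re0 : 0 < complex.Re e by move: e0; rewrite er ltcR.
exists (Num.bound (complex.Re e)^-1) => n leN.
have h : (complex.Re e)^-1 < n.+1%:R.
  apply: lt_le_trans (archi_boundP _) _; first by rewrite invr_ge0 ltW.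
  by rewrite ler_nat (leq_trans leN).
have {}h : n.+1%:R^-1 < complex.Re e by rewrite -[ltRHS]invrK ltf_pV2 ?posrE ?invr_gt0 ?ltr0n.
rewrite er (_ : n.+1%:R^-1 = (n.+1%:R^-1 : R)%:C%C) ?ltcR//.
by rewrite fmorphV/= rmorph_nat.
Qed.

Lemma normc_ge_Im (x : C) : `|complex.Im x|%:C%C <= `|x|.
Proof.
by case: x => a b; simpc; rewrite -sqrtr_sqr ler_wsqrtr // lerDr sqr_ge0.
Qed.

Lemma lt_half (e : C) : 0 < e -> 0 < e / 2.
Proof. by move=> e0; rewrite divr_gt0// ltr0n. Qed.

Lemma seq_lim_unique a l l' : seq_lim a l -> seq_lim a l' -> l = l'.
Proof.
move=> al al'; apply/eqP; rewrite -subr_eq0 -normr_eq0; apply/negPn/negP => n0.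
have e0 : 0 < `|l - l'| by rewrite lt_def n0 normr_ge0.
have [N hN] := al _ (lt_half e0); have [N' hN'] := al' _ (lt_half e0).
have := ltrD (hN _ (leq_maxl N N')) (hN' _ (leq_maxr N N')).
rewrite -splitr distrC => h.
have := le_lt_trans (ler_normD (l - a (maxn N N')) (a (maxn N N') - l')) h.
by rewrite addrA subrK ltxx.
Qed.

Lemma seq_limD a b l m : seq_lim a l -> seq_lim b m ->
  seq_lim (fun n => a n + b n) (l + m).
Proof.
move=> al bm e e0.
have [N hN] := al _ (lt_half e0); have [N' hN'] := bm _ (lt_half e0).
exists (maxn N N') => n; rewrite geq_max => /andP[n1 n2].
rewrite opprD addrACA (le_lt_trans (ler_normD _ _))// (splitr e) ltrD//.
  exact: hN.
exact: hN'.
Qed.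

Lemma seq_limZ c a l : seq_lim a l -> seq_lim (fun n => c * a n) (c * l).
Proof.
move=> al e e0; have c0 : 0 < `|c| + 1 by rewrite ltr_wpDl.
have [N hN] := al _ (divr_gt0 e0 c0); exists N => n /hN h.
rewrite -mulrBr normrM.
have : (`|c| + 1) * `|a n - l| < e by rewrite mulrC -ltr_pdivlMr.
by apply: le_lt_trans; rewrite ler_wpM2r// lerDl.
Qed.

Lemma seq_lim_conj a l : seq_lim a l -> seq_lim (fun n => (a n)^*) l^*.
Proof.
move=> al e e0; have [N hN] := al _ e0; exists N => n /hN.
by rewrite -rmorphB norm_conjC.
Qed.

Lemma seq_lim_cst c : seq_lim (fun=> c) c.
Proof. by move=> e e0; exists 0%N => n _; rewrite subrr normr0. Qed.

Lemma seq_lim_le (a : nat -> C) l b N :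
  (forall n, (N <= n)%N -> `|a n| <= b) -> seq_lim a l -> `|l| <= b.
Proof.
move=> ab al; have br : b \is Num.real.
  by apply: ger0_real; apply: le_trans (ab N (leqnn _)); rewrite normr_ge0.
rewrite real_leNgt ?normr_real//; apply/negP => lt.
have e0 : 0 < `|l| - b by rewrite subr_gt0.
have [N' hN'] := al _ e0.
have := hN' _ (leq_maxr N N'); have := ab _ (leq_maxl N N').
set n := maxn N N' => h1 h2.
have : `|l| < `|l|.
  rewrite -{1}(subrK (a n) l) (le_lt_trans (ler_normD _ _))//.
  by rewrite -[ltRHS](subrK b) ltr_leD// distrC.
by rewrite ltxx.
Qed.

Lemma seq_lim_ge0 (a : nat -> C) l :
  (forall n, 0 <= a n) -> seq_lim a l -> 0 <= l.
Proof.
move=> a0 al; suff -> : l = `|l| by rewrite normr_ge0.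
apply: (seq_lim_unique al) => e e0; have [N hN] := al _ e0.
exists N => n /hN; apply: le_lt_trans.
by rewrite -{1}(ger0_norm (a0 n)) ler_dist_dist.
Qed.

Lemma seq_complete a : seq_cauchy a -> exists l, seq_lim a l.
Proof.
move=> ca.
have part (f : C -> R) : (forall x y, f (x - y) = f x - f y) ->
    (forall x, `|f x|%:C%C <= `|x|) ->
    exists l, forall e : R, 0 < e -> exists N, forall n, (N <= n)%N -> `|f (a n) - l| < e.
  move=> fB fle.
  have cf : cauchy ((fun n => f (a n)) @ \oo).
    apply/cauchy_ballP => e e0.
    have [|N hN] := ca (e%:C)%C; first by rewrite ltcR.
    exists ([set f (a n) | n in [set n | (N <= n)%N]],
            [set f (a n) | n in [set n | (N <= n)%N]]).
      by split; exists N => // n /= leN; exists n.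
    move=> [x y] /= [[m leNm <-] [n leNn <-]].
    rewrite /ball/= -fB -ltcR (le_lt_trans (fle _))//; exact: hN.
  have cvf : cvg ((fun n => f (a n)) @ \oo) by exact: R_complete.
  move/cvg_ex : cvf => [l hl]; exists l => e e0.
  move/cvgrPdist_lt : hl => /(_ e e0)[N _ hN]; exists N => n /hN.
  by rewrite distrC.
have [x hx] := part (@complex.Re R) (fun _ _ => raddfB _ _ _)
  (fun z => normc_ge_Re z).
have [y hy] := part (@complex.Im R) (fun _ _ => raddfB _ _ _)
  (fun z => normc_ge_Im z).
exists (x +i* y)%C => e e0.
have er : e = (complex.Re e)%:C%C by rewrite RRe_real// gtr0_real.
have re0 : 0 < complex.Re e / 2 by rewrite divr_gt0// -ltcR -er.
have [N hN] := hx _ re0; have [N' hN'] := hy _ re0.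
exists (maxn N N') => n; rewrite geq_max => /andP[/hN h1 /hN' h2].
have -> : a n - (x +i* y)%C = (complex.Re (a n) - x)%:C%C + 'i%C * (complex.Im (a n) - y)%:C%C.
  by case: (a n) => u v; simpc.
rewrite (le_lt_trans (ler_normD _ _))// normrM.
have -> : `|'i%C : C| = 1 by rewrite normc_def/= expr0n/= expr1n add0r sqrtr1.
rewrite mul1r.
have nr (r : R) : `|(r%:C)%C : C| = (`|r|%:C)%C.
  by rewrite normc_def/= expr0n/= addr0 sqrtr_sqr.
by rewrite !nr -rmorphD/= er ltcR (splitr (complex.Re e)) ltrD.
Qed.
End ComplexSequences.

Section ScalarInequalities.
Variable C : numClosedFieldType.
Implicit Types a b c : C.

Lemma cauchy_schwarz_scalar a b c : 0 <= a -> 0 <= b ->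
  (forall z, 0 <= a + z^* * c + z * c^* + `|z| ^+ 2 * b) -> `|c| ^+ 2 <= a * b.
Proof.
move=> a0 b0 h.
have key t : 0 <= t -> 0 <= a - 2 * t * `|c| ^+ 2 + t ^+ 2 * `|c| ^+ 2 * b.
  move=> t0; have := h (- t * c).
  have tc : t^* = t by apply/CrealP/ger0_real.
  rewrite rmorphM rmorphN/= tc normrM normrN (ger0_norm t0) exprMn.
  move=> h1; apply: (le_trans h1); rewrite le_eqVlt; apply/orP; left; apply/eqP.
  by rewrite normCK; ring.
have [b00|bn0] := eqVneq b 0.
  rewrite b00 mulr0 real_leNgt ?rpredX ?normr_real ?rpred0//; apply/negP => c0.
  have /key : 0 <= (a + 1) / `|c| ^+ 2 by rewrite divr_ge0 ?addr_ge0 ?(ltW c0).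
  rewrite b00 mulr0 addr0 -mulrA divfK ?gt_eqF//.
  have -> : a - 2 * (a + 1) = - (a + 2) by ring.
  rewrite oppr_ge0 => h1; have : 0 < a + 2 by rewrite ltr_wpDl.
  by move=> /lt_le_trans/(_ h1); rewrite ltxx.
have bp : 0 < b by rewrite lt_def bn0.
have /key : 0 <= b^-1 by rewrite invr_ge0.
have -> : b^-1 ^+ 2 * `|c| ^+ 2 * b = b^-1 * `|c| ^+ 2.
  by field.
rewrite (_ : _ + _ = a - b^-1 * `|c| ^+ 2) ?subr_ge0; last by ring.
by rewrite mulrC ler_pdivrMr.
Qed.

Lemma triangle_scalar a b c : 0 <= a -> 0 <= b -> `|c| ^+ 2 <= a * b ->
  0 <= a + b + (c + c^*) ->
  sqrtC (a + b + (c + c^*)) <= sqrtC a + sqrtC b.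
Proof.
move=> a0 b0 cab s0.
rewrite -[leRHS]sqrCK ?addr_ge0 ?sqrtC_ge0// ler_sqrtC ?nnegrE ?s0 ?exprn_ge0 ?addr_ge0 ?sqrtC_ge0//.
rewrite sqrrD !sqrtCK [leRHS]addrAC lerD2l.
have cs : `|c| <= sqrtC a * sqrtC b.
  by rewrite -rootCMl// -[leLHS]sqrCK// ler_sqrtC ?nnegrE ?exprn_ge0 ?mulr_ge0.
apply: le_trans (_ : `|c| *+ 2 <= _); last by rewrite ler_wMn2r.
have r : c + c^* \is Num.real by rewrite CrealE rmorphD/= conjCK addrC.
rewrite (le_trans (real_ler_norm r))// (le_trans (ler_normD _ _))//.
by rewrite norm_conjC mulr2n.
Qed.
End ScalarInequalities.

Section DotNorm.
Variables (C : numClosedFieldType) (U : lmodType C) (form : {dot U for @Num.conj C}).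

Lemma dot_cauchy_schwarz u v : `|form u v| ^+ 2 <= form u u * form v v.
Proof.
apply: cauchy_schwarz_scalar => [||z]; rewrite ?dnorm_ge0//.
have := dnorm_ge0 form (u + z *: v).
rewrite dnormD/= dnormZ linearZr_LR/= rmorphM/= conjCK.
by congr (0 <= _); ring.
Qed.

Lemma dot_triangle u v :
  sqrtC (form (u + v) (u + v)) <= sqrtC (form u u) + sqrtC (form v v).
Proof.
rewrite dnormD/=; apply: triangle_scalar; rewrite ?dnorm_ge0 ?dot_cauchy_schwarz//.
by rewrite -dnormD dnorm_ge0.
Qed.

End DotNorm.

HB.factory Record Lmodule_isHilbert (R : realType) H & GRing.Lmodule R[i] H := {
  dot : {dot H for @Num.conj R[i]};
  dot_complete : forall u : nat -> H,
    (forall e, 0 < e -> exists N, forall m n, (N <= m)%N -> (N <= n)%N ->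
      sqrtC (dot (u m - u n) (u m - u n)) < e) ->
    exists l, forall e, 0 < e -> exists N, forall n, (N <= n)%N ->
      sqrtC (dot (u n - l) (u n - l)) < e
}.

HB.builders Context R H & Lmodule_isHilbert R H.

Let nrm (x : H) := sqrtC (dot x x).

Let nrmD x y : nrm (x + y) <= nrm x + nrm y.
Proof. exact: dot_triangle. Qed.

Let nrmZ (l : R[i]) (x : H) : nrm (l *: x) = `|l| * nrm x.
Proof. by rewrite /nrm dnormZ rootCMl ?exprn_ge0// sqrCK. Qed.

Let nrm0 x : nrm x = 0 -> x = 0.
Proof. by move=> /eqP; rewrite sqrt_dnorm_eq0 => /eqP. Qed.

HB.instance Definition _ := Lmodule_isNormed.Build R[i] H nrmD nrmZ nrm0.

Let nrm_complete (F : set_system H) : ProperFilter F -> cauchy F -> cvg F.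
Proof.
move=> FF Fc.
have /choice[u hu] n : exists x, F (ball x (n.+1%:R^-1 : R[i])).
  move/cauchyP : Fc => /(_ n.+1%:R^-1).
  by rewrite invr_gt0 ltr0n => /(_ isT)[x]; exists x.
have dist m n : `|u m - u n| < m.+1%:R^-1 + n.+1%:R^-1.
  have [x [xm xn]] := filter_ex (filterI (hu m) (hu n)).
  move: xm xn; rewrite -ball_normE/= => xm xn.
  by rewrite -(subrK x (u m)) -addrA (le_lt_trans (ler_normD _ _))// ltrD// distrC.
have [|l hl] := @dot_complete u.
  move=> e e0; have [N hN] := invn_lt (lt_half e0); exists N => m n /hN Nm /hN Nn.
  by rewrite (splitr e) (lt_trans (dist m n))// ltrD.
apply/cvg_ex; exists l; apply/cvgrPdist_lt => e e0.
have [N hN] := invn_lt (lt_half e0); have [N' hN'] := hl _ (lt_half e0).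
apply: filterS (hu (maxn N N')) => x; rewrite -ball_normE/= => ux.
have := hN' _ (leq_maxr N N') : `|u _ - l| < _; have := hN _ (leq_maxl N N').
set n := maxn _ _ in ux * => h1 h2.
rewrite -(subrK (u n) l) -addrA (le_lt_trans (ler_normD _ _))// (splitr e) ltrD//.
  by rewrite distrC.
exact: lt_trans h1.
Qed.

HB.instance Definition _ := Uniform_isComplete.Build H nrm_complete.

Let nrmE (x : H) : `|x| ^+ 2 = dot x x.
Proof. exact: sqrtCK. Qed.

HB.instance Definition _ := CompleteNormedModule_isHilbert.Build R H nrmE.

HB.end.

Section Completion.
Variable R : realType.
Local Notation C := R[i].
Variables (P : Type) (zero : P) (add : P -> P -> P) (scl : C -> P -> P).
Variable g : P -> P -> C.
Hypothesis g0 : forall r, g zero r = 0.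
Hypothesis gD : forall p q r, g (add p q) r = g p r + g q r.
Hypothesis gZ : forall a p r, g (scl a p) r = a * g p r.
Hypothesis gC : forall p q, g p q = (g q p)^*.
Hypothesis g_ge0 : forall p, 0 <= g p p.

Let gDr p q r : g r (add p q) = g r p + g r q.
Proof. by rewrite gC gD rmorphD/= -!gC. Qed.
Let gZr a p r : g r (scl a p) = a^* * g r p.
Proof. by rewrite gC gZ rmorphM/= -!gC. Qed.

Let sub p q := add p (scl (-1) q).
Let gB p q r : g (sub p q) r = g p r - g q r.
Proof. by rewrite gD gZ mulN1r. Qed.
Let gBr p q r : g r (sub p q) = g r p - g r q.
Proof. by rewrite gDr gZr rmorphN1 mulN1r. Qed.

Let N p := sqrtC (g p p).
Let N_ge0 p : 0 <= N p. Proof. by rewrite sqrtC_ge0. Qed.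
Let NK p : N p ^+ 2 = g p p. Proof. exact: sqrtCK. Qed.

Let cs p q : `|g p q| <= N p * N q.
Proof.
rewrite -[leLHS]sqrCK// -rootCMl// ler_sqrtC ?nnegrE ?exprn_ge0 ?mulr_ge0//.
apply: cauchy_schwarz_scalar => // z.
have := g_ge0 (add p (scl z q)); rewrite gD !gDr !gZ !gZr (gC q p) normCK.
by congr (0 <= _); ring.
Qed.

Let N_triangle p q r : N (sub p r) <= N (sub p q) + N (sub q r).
Proof.
have e : g (sub p r) (sub p r) = g (sub p q) (sub p q) + g (sub q r) (sub q r)
    + (g (sub p q) (sub q r) + (g (sub p q) (sub q r))^*).
  by rewrite -gC !gB !gBr; ring.
rewrite {1}/N e; apply: triangle_scalar; rewrite -?e//.
by rewrite -!NK -exprMn lerXn2r ?nnegrE ?mulr_ge0// ?normr_ge0.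
Qed.

Let N_sym p q : N (sub p q) = N (sub q p).
Proof. by rewrite /N !gB !gBr; congr sqrtC; ring. Qed.

Let cau (u : nat -> P) := forall e, 0 < e -> exists n0, forall m n,
  (n0 <= m)%N -> (n0 <= n)%N -> N (sub (u m) (u n)) < e.

Let rep (phi : P -> C) u := cau u /\ forall q, seq_lim (fun n => g (u n) q) (phi q).

Let rep_sub phi psi u v : rep phi u -> rep psi v ->
  rep (phi - psi) (fun n => sub (u n) (v n)).
Proof.
move=> [cu hu] [cv hv]; split.
  move=> e e0; have [n1 h1] := cu _ (lt_half e0); have [n2 h2] := cv _ (lt_half e0).
  exists (maxn n1 n2) => m n; rewrite !geq_max => /andP[m1 m2] /andP[k1 k2].
  have := ltrD (h1 _ _ m1 k1) (h2 _ _ m2 k2); rewrite -splitr.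
  apply: le_lt_trans; rewrite (N_sym (v m)).
  have e' : g (sub (sub (u m) (v m)) (sub (u n) (v n))) (sub (sub (u m) (v m)) (sub (u n) (v n)))
    = g (sub (u m) (u n)) (sub (u m) (u n)) + g (sub (v n) (v m)) (sub (v n) (v m))
    + (g (sub (u m) (u n)) (sub (v n) (v m)) + (g (sub (u m) (u n)) (sub (v n) (v m)))^*).
    by rewrite -gC !gB !gBr; ring.
  rewrite {1}/N e'; apply: triangle_scalar; rewrite -?e'//.
  by rewrite -!NK -exprMn lerXn2r ?nnegrE ?mulr_ge0// ?normr_ge0.
move=> q; have := seq_limD (hu q) (seq_limZ (-1) (hv q)).
rewrite mulN1r => h e e0; have [n0 hn] := h _ e0; exists n0 => n /hn.
by rewrite gB mulN1r.
Qed.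

Let rep0 : rep 0 (fun=> zero).
Proof.
split=> [e e0|q]; first by exists 0%N => m n _ _; rewrite /N gB !gBr !g0 !subrr sqrtC0.
by rewrite g0; exact: seq_lim_cst.
Qed.

Let repZ a phi u : rep phi u -> rep (a *: phi) (fun n => scl a (u n)).
Proof.
move=> [cu hu]; split=> [e e0|q].
  have a0 : 0 < `|a| + 1 by rewrite ltr_wpDl.
  have [n0 h] := cu _ (divr_gt0 e0 a0); exists n0 => m n m0 n0'.
  have -> : N (sub (scl a (u m)) (scl a (u n))) = `|a| * N (sub (u m) (u n)).
    rewrite -[LHS]sqrCK ?N_ge0// -[RHS]sqrCK ?mulr_ge0// exprMn !NK normCK.
    by congr sqrtC; rewrite !gB !gBr !gZ !gZr; ring.
  have := h _ _ m0 n0'; rewrite ltr_pdivlMr// mulrC; apply: le_lt_trans.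
  by rewrite ler_wpM2r// lerDl.
by have := seq_limZ a (hu q); move=> h e e0; have [n0 hn] := h _ e0;
  exists n0 => n /hn; rewrite gZ.
Qed.

Let repD phi psi u v : rep phi u -> rep psi v ->
  exists w, rep (phi + psi) w.
Proof.
move=> hu /(repZ (-1)) hv; have := rep_sub hu hv.
by rewrite scaleN1r opprK; eexists; eassumption.
Qed.

Let iota p : P -> C := g p.
Let rep_iota p : rep (iota p) (fun=> p).
Proof.
split=> [e e0|q]; last exact: seq_lim_cst.
by exists 0%N => m n _ _; rewrite /N gB !gBr !subrr sqrtC0.
Qed.

Let cau_bounded u : cau u -> exists2 b, 0 < b & forall n, N (u n) <= b.
Proof.
move=> cu; have [n0 h] := cu _ ltr01.
pose b := \sum_(i < n0.+1) N (u i) + 1.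
have s0 : 0 <= \sum_(i < n0.+1) N (u i) by apply: sumr_ge0.
have lb i : (i < n0.+1)%N -> N (u i) <= \sum_(i < n0.+1) N (u i).
  move=> li; rewrite (bigD1 (Ordinal li))//= lerDl; exact: sumr_ge0.
exists b => [|n]; first by rewrite ltr_wpDl.
have [ln|ln] := ltnP n n0.+1; first by rewrite (le_trans (lb _ ln))// lerDl.
have d : N (sub (u n) (u n0)) <= 1 by apply/ltW/h => //; exact: ltnW.
have t : N (u n) <= N (u n0) + N (sub (u n) (u n0)).
  have e : g (u n) (u n) = g (u n0) (u n0) + g (sub (u n) (u n0)) (sub (u n) (u n0))
    + (g (u n0) (sub (u n) (u n0)) + (g (u n0) (sub (u n) (u n0)))^*).
    by rewrite -gC !gB !gBr; ring.
  rewrite {1}/N e; apply: triangle_scalar; rewrite -?e//.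
  by rewrite -!NK -exprMn lerXn2r ?nnegrE ?mulr_ge0// ?normr_ge0.
by rewrite (le_trans t)// lerD// lb.
Qed.

Let rep_bound phi u : rep phi u -> exists2 b, 0 < b & forall q, `|phi q| <= b * N q.
Proof.
move=> [/cau_bounded[b b0 hb] hu]; exists b => // q.
apply: (seq_lim_le (N := 0)) (hu q) => n _.
by rewrite (le_trans (cs _ _))// ler_wpM2r.
Qed.

Let rep_funB phi u p q : rep phi u -> phi (sub p q) = phi p - phi q.
Proof.
move=> [_ hu]; apply: seq_lim_unique (hu _) _.
have := seq_limD (hu p) (seq_limZ (-1) (hu q)); rewrite mulN1r => h e e0.
have [n0 hn] := h _ e0; exists n0 => n /hn.
by rewrite gBr mulN1r.
Qed.

Let rep_close phi u b n v : rep phi u -> (forall m, (n <= m)%N -> N (sub (u m) (u n)) <= b) ->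
  `|phi v - g (u n) v| <= b * N v.
Proof.
move=> [cu hu] hb.
have h : seq_lim (fun m => g (sub (u m) (u n)) v) (phi v - g (u n) v).
  move=> e e0; have [n0 hn] := hu v _ e0; exists n0 => m /hn.
  by rewrite gB opprB addrA subrK.
apply: (seq_lim_le (N := n)) h => m nm.
by rewrite (le_trans (cs _ _))// ler_wpM2r// hb.
Qed.

Let rep0_lim phi u w : rep phi u -> rep 0 w -> seq_lim (phi \o w) 0.
Proof.
move=> ru [/cau_bounded[b b0 hb] hw] e e0.
have [M hM] := ru.1 _ (divr_gt0 (lt_half e0) b0).
have hM' m : (M <= m)%N -> N (sub (u m) (u M)) <= e / 2 / b by move=> ?; apply/ltW/hM.
have [n0 h0] := hw (u M) _ (lt_half e0).
exists n0 => n /h0; rewrite !subr0 gC norm_conjC => h1 /=.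
rewrite -(subrK (g (u M) (w n)) (phi (w n))) (le_lt_trans (ler_normD _ _))//.
rewrite (splitr e) ler_ltD// (le_trans (rep_close _ ru hM'))//.
by rewrite mulrAC ler_pdivrMr// ler_wpM2l ?(ltW (lt_half e0)) ?hb.
Qed.

(* A point phi of the completion is represented by the conjugate-linear map
   q |-> <phi, q> on P, the pointwise limit of g (u n) for a Cauchy sequence u
   in P; points of P at distance 0 are thereby identified. *)
Definition completion_pred : {pred P -> C} := fun phi => `[< exists u, rep phi u >].

Fact completion_submod : submod_closed completion_pred.
Proof.
split=> [|a phi psi /asboolP[u hu] /asboolP[v hv]]; apply/asboolP.
  by exists (fun=> zero).
by have [w hw] := repD (repZ a hu) hv; exists w.
Qed.

HB.instance Definition _ :=
  GRing.isSubmodClosed.Build C (P -> C) completion_pred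
    (GRing.submod_closed_semi completion_submod).
HB.instance Definition _ :=
  GRing.isOppClosed.Build (P -> C) completion_pred
    (GRing.zmod_closedN (GRing.submod_closedB completion_submod)).

Record completion := Completion {
  completion_fun :> P -> C;
  completion_funP : completion_fun \in completion_pred }.

HB.instance Definition _ := [isSub for completion_fun].
HB.instance Definition _ := [Choice of completion by <:].
HB.instance Definition _ := [SubChoice_isSubLmodule of completion by <:].

Let repT (x : completion) : exists u, rep x u.
Proof. exact/asboolP/completion_funP. Qed.
Let ch (x : completion) : nat -> P := projT1 (cid (repT x)).
Let chP (x : completion) : rep x (ch x). Proof. exact: projT2 (cid (repT x)). Qed.

Let D_ex (x y : completion) : exists l, seq_lim (x \o ch y) l.
Proof.
apply: seq_complete => e e0; have [b b0 hb] := rep_bound (chP x).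
have [n0 h] := (chP y).1 _ (divr_gt0 e0 b0); exists n0 => m n nm nn /=.
rewrite -(rep_funB _ _ (chP x)) (le_lt_trans (hb _))// mulrC -ltr_pdivlMr//.
exact: h.
Qed.
Let D x y : C := projT1 (cid (D_ex x y)).

Let D_lim (x y : completion) v : rep y v -> seq_lim (x \o v) (D x y).
Proof.
move=> rv; have := projT2 (cid (D_ex x y)); rewrite -/(D x y) => h1.
have := rep_sub rv (chP y); rewrite subrr => /(rep0_lim (chP x)) h2.
have := seq_limD h1 h2; rewrite addr0 => h e e0.
have [n0 hn] := h _ e0; exists n0 => n /hn /=.
by rewrite (rep_funB _ _ (chP x)) addrCA subrr addr0.
Qed.

Let D_lim2 (x y : completion) u v : rep x u -> rep y v ->
  seq_lim (fun n => g (u n) (v n)) (D x y).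
Proof.
move=> ru rv e e0; have [b b0 hb] := cau_bounded rv.1.
have [n1 h1] := D_lim x rv (lt_half e0).
have [n2 h2] := ru.1 _ (divr_gt0 (lt_half e0) b0).
exists (maxn n1 n2) => n; rewrite geq_max => /andP[/h1 k1 k2].
have hM m : (n <= m)%N -> N (sub (u m) (u n)) <= e / 2 / b.
  by move=> nm; apply/ltW/h2 => //; exact: leq_trans nm.
rewrite -(subrK (x (v n)) (g (u n) (v n))) -addrA (le_lt_trans (ler_normD _ _))//.
rewrite (splitr e) ler_ltD// distrC (le_trans (rep_close _ ru hM))//.
by rewrite mulrAC ler_pdivrMr// ler_wpM2l ?(ltW (lt_half e0)) ?hb.
Qed.

Let DC x y : D x y = (D y x)^*.
Proof.
apply: seq_lim_unique (D_lim2 (chP x) (chP y)) _.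
have := seq_lim_conj (D_lim2 (chP y) (chP x)) => h e e0.
by have [n0 hn] := h _ e0; exists n0 => n /hn; rewrite -gC.
Qed.

Let D_ge0 x : 0 <= D x x.
Proof. exact: seq_lim_ge0 (D_lim2 (chP x) (chP x)). Qed.

Let D_linear y : linear_for *%R (D^~ y).
Proof.
move=> a x x'; apply: seq_lim_unique (D_lim _ (chP y)) _.
have := seq_limD (seq_limZ a (D_lim x (chP y))) (D_lim x' (chP y)).
by [].
Qed.

Let D_linearr x : linear_for (@Num.conj C \; *%R) (D x).
Proof.
by move=> a y y'; rewrite DC D_linear rmorphD rmorphM/= -!DC.
Qed.

Let iota_in p : iota p \in completion_pred.
Proof. by apply/asboolP; exists (fun=> p); exact: rep_iota. Qed.
Let emb p := Completion (iota_in p).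

Let D_emb x p : D x (emb p) = x p.
Proof. apply: seq_lim_unique (@D_lim x (emb p) _ (rep_iota p)) _; exact: seq_lim_cst. Qed.

Let D_def x : x != 0 -> 0 < D x x.
Proof.
move=> xn0; rewrite lt_def D_ge0 andbT; apply: contra_neq xn0 => x0.
apply: val_inj; apply/funext => p /=; apply/eqP; rewrite -normr_eq0 -sqrf_eq0.
rewrite eq_le exprn_ge0// andbT -(mul0r (g p p)) -x0.
apply: cauchy_schwarz_scalar => // z; have := D_ge0 (z *: emb p + x).
rewrite D_linear !D_linearr D_emb /= (DC (emb p)) !D_emb /=.
rewrite normCK /=. by congr (0 <= _); rewrite /iota; ring.
Qed.

HB.instance Definition _ := @bilinear_isBilinear.Build C completion completion C
  ( *%R ) (@Num.conj C \; *%R) D (D_linear, D_linearr).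

Let D_herm x y : D x y = (-1) ^+ false * (D y x)^*.
Proof. by rewrite expr0 mul1r DC. Qed.

HB.instance Definition _ := @isHermitianSesquilinear.Build C completion false
  (@Num.conj C) D D_herm.
HB.instance Definition _ := @isDotProduct.Build C completion D D_def.

Let Ddot : {dot completion for @Num.conj C} := D.

Let D_close (x : completion) u b n : rep x u -> 0 <= b ->
  (forall m, (n <= m)%N -> N (sub (u m) (u n)) <= b) ->
  sqrtC (D (x - emb (u n)) (x - emb (u n))) <= b.
Proof.
move=> ru b0 hb; have r := rep_sub ru (rep_iota (u n)).
rewrite -[leRHS]sqrCK// ler_sqrtC ?nnegrE ?exprn_ge0//.
rewrite -[leLHS]ger0_norm//; apply: (seq_lim_le (N := n)) (@D_lim2 (x - emb (u n)) (x - emb (u n)) _ _ r r) => m nm.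
by rewrite ger0_norm// -NK lerXn2r ?nnegrE// hb.
Qed.

Let density x e : 0 < e -> exists p, sqrtC (D (x - emb p) (x - emb p)) < e.
Proof.
move=> e0; have [n0 h] := (chP x).1 _ (lt_half e0); exists (ch x n0).
have h' m : (n0 <= m)%N -> N (sub (ch x m) (ch x n0)) <= e / 2 by move=> ?; apply/ltW/h.
rewrite (le_lt_trans (D_close (chP x) (ltW (lt_half e0)) h'))//.
by rewrite ltr_pdivrMr ?ltr0n// ltr_pMr// ltr1n.
Qed.

Let nrmC (x y : completion) : sqrtC (D (x - y) (x - y)) = sqrtC (D (y - x) (y - x)).
Proof. by rewrite -(opprB y x) (hnormN Ddot). Qed.

Let D_complete (u : nat -> completion) :
  (forall e, 0 < e -> exists N, forall m n, (N <= m)%N -> (N <= n)%N ->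
    sqrtC (Ddot (u m - u n) (u m - u n)) < e) ->
  exists l, forall e, 0 < e -> exists N, forall n, (N <= n)%N ->
    sqrtC (Ddot (u n - l) (u n - l)) < e.
Proof.
move=> cu.
have /choice[p hp] n : exists p, sqrtC (D (u n - emb p) (u n - emb p)) < n.+1%:R^-1.
  by apply: density; rewrite invr_gt0 ltr0n.
have tri (x y z : completion) : sqrtC (D (x - z) (x - z)) <=
    sqrtC (D (x - y) (x - y)) + sqrtC (D (y - z) (y - z)).
  by have := dot_triangle Ddot (x - y) (y - z); rewrite addrA subrK.
have NE q r : N (sub q r) = sqrtC (D (emb q - emb r) (emb q - emb r)).
  congr sqrtC; apply: seq_lim_unique (@D_lim2 (emb q - emb r) (emb q - emb r) (fun=> sub q r) (fun=> sub q r) _ _); last first.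
  - exact: rep_sub (rep_iota q) (rep_iota r).
  - exact: rep_sub (rep_iota q) (rep_iota r).
  exact: seq_lim_cst.
have cp : cau p.
  move=> e e0; have e3 : 0 < e / 2 / 2 by do 2 apply: lt_half.
  have [n1 h1] := invn_lt e3; have [n2 h2] := cu _ (lt_half e0).
  exists (maxn n1 n2) => m n; rewrite !geq_max => /andP[m1 m2] /andP[k1 k2].
  rewrite NE (le_lt_trans (tri _ (u m) _))// (splitr e) {1}(splitr (e / 2)).
  rewrite -addrA ltrD//; first by rewrite nrmC (lt_trans (hp _))// h1.
  rewrite addrC (le_lt_trans (tri _ (u n) _))// ltrD//; first exact: h2.
  by rewrite (lt_trans (hp _))// h1.
have /choice[psi hpsi] q : exists l, seq_lim (fun n => g (p n) q) l.
  apply: seq_complete => e e0; have Nq : 0 < N q + 1 by rewrite ltr_wpDl.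
  have [n0 h] := cp _ (divr_gt0 e0 Nq); exists n0 => m n nm nn.
  rewrite -gB (le_lt_trans (cs _ _))//.
  have := h _ _ nm nn; rewrite ltr_pdivlMr//; apply: le_lt_trans.
  by rewrite ler_wpM2l// lerDl.
have rpsi : rep psi p by [].
have psi_in : psi \in completion_pred by apply/asboolP; exists p.
exists (Completion psi_in) => e e0.
have [n1 h1] := invn_lt (lt_half e0); have [n2 h2] := cp _ (lt_half (lt_half e0)).
exists (maxn n1 n2) => n; rewrite geq_max => /andP[k1 k2].
rewrite /Ddot/= (le_lt_trans (tri _ (emb (p n)) _))// (splitr e) ltrD//.
  by rewrite (lt_trans (hp _))// h1.
rewrite nrmC.
have h' m : (n <= m)%N -> N (sub (p m) (p n)) <= e / 2 / 2.
  by move=> nm; apply/ltW/h2 => //; exact: leq_trans nm.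
rewrite (le_lt_trans (D_close (x := Completion psi_in) rpsi (ltW (lt_half (lt_half e0))) h'))//.
by rewrite ltr_pdivrMr ?ltr0n// ltr_pMr ?lt_half// ltr1n.
Qed.

HB.instance Definition _ := Lmodule_isHilbert.Build R completion D_complete.

Lemma completion_exists : exists (T : hilbertType R) (i : P -> T),
  (forall p q, inner (i p) (i q) = g p q) /\
  (forall x e, 0 < e -> exists p, `|x - i p| < e).
Proof.
exists completion, emb; split=> [p q|x e e0]; last exact: density.
exact: D_emb.
Qed.
End Completion.

Section InnerTheory.
Variables (R : realType) (H : hilbertType R).
Implicit Types x y z : H.
Local Notation C := R[i].

Lemma innerC x y : inner x y = (inner y x)^*.
Proof. by rewrite (hermC inner) expr0 mul1r. Qed.
Lemma innerDl x y z : inner (x + y) z = inner x z + inner y z.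
Proof. exact: linearDl. Qed.
Lemma innerDr x y z : inner z (x + y) = inner z x + inner z y.
Proof. exact: linearDr. Qed.
Lemma innerZl (a : C) x z : inner (a *: x) z = a * inner x z.
Proof. exact: linearZl_LR. Qed.
Lemma innerZr (a : C) x z : inner z (a *: x) = a^* * inner z x.
Proof. exact: linearZr_LR. Qed.
Lemma innerBl x y z : inner (x - y) z = inner x z - inner y z.
Proof. by rewrite innerDl -scaleN1r innerZl mulN1r. Qed.
Lemma innerBr x y z : inner z (x - y) = inner z x - inner z y.
Proof. by rewrite innerDr -scaleN1r innerZr rmorphN1 mulN1r. Qed.
Lemma inner0l z : inner 0 z = 0.
Proof. by rewrite -(scale0r 0) innerZl mul0r. Qed.
Lemma inner0r z : inner z 0 = 0.
Proof. by rewrite innerC inner0l conjC0. Qed.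
Lemma inner_eq0 x : inner x x = 0 -> x = 0.
Proof.
by move=> /eqP; rewrite -sqr_normE sqrf_eq0 normr_eq0 => /eqP.
Qed.
Lemma inner_suml I (s : seq I) (F : I -> H) z :
  inner (\sum_(i <- s) F i) z = \sum_(i <- s) inner (F i) z.
Proof.
by elim: s => [|i s IH]; rewrite ?big_nil ?inner0l// !big_cons innerDl IH.
Qed.
Lemma inner_sumr I (s : seq I) (F : I -> H) z :
  inner z (\sum_(i <- s) F i) = \sum_(i <- s) inner z (F i).
Proof.
by elim: s => [|i s IH]; rewrite ?big_nil ?inner0r// !big_cons innerDr IH.
Qed.
Lemma inner_ext x y : (forall z, inner x z = inner y z) -> x = y.
Proof.
move=> h; apply/eqP; rewrite -subr_eq0; apply/eqP/inner_eq0.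
by rewrite innerBl h subrr.
Qed.
End InnerTheory.

Section FormalSums.
Variables (R : realType) (H K : hilbertType R).
Local Notation C := R[i].

(* [s : fsum] stands for the sum of the elementary tensors x.1 ⊗ x.2, x in s. *)
Definition fsum := seq (H * K).
Definition fscale (a : C) (s : fsum) : fsum := [seq (a *: x.1, x.2) | x <- s].
Definition fform (s t : fsum) : C :=
  \sum_(x <- s) \sum_(y <- t) inner x.1 y.1 * inner x.2 y.2.

Lemma fform0 t : fform [::] t = 0.
Proof. by rewrite /fform big_nil. Qed.

Lemma fformD s1 s2 t : fform (s1 ++ s2) t = fform s1 t + fform s2 t.
Proof. by rewrite /fform big_cat. Qed.

Lemma fformZ a s t : fform (fscale a s) t = a * fform s t.
Proof.
rewrite /fform big_map mulr_sumr; apply: eq_bigr => x _.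
by rewrite mulr_sumr; apply: eq_bigr => y _; rewrite innerZl mulrA.
Qed.

Lemma fformC s t : fform s t = (fform t s)^*.
Proof.
rewrite /fform exchange_big rmorph_sum; apply: eq_bigr => y _.
rewrite rmorph_sum; apply: eq_bigr => x _.
by rewrite rmorphM/= -!innerC.
Qed.

Fixpoint orthonormal2 (s : fsum) : Prop := if s is x :: s' then
  [/\ inner x.2 x.2 = 1, forall y, y \in s' -> inner x.2 y.2 = 0 & orthonormal2 s']
  else True.

(* A formal sum can be rewritten, without changing the value of any bilinear
   form on it, so that its second components are orthonormal. *)
Lemma gram_schmidt (s : fsum) : exists2 s' : fsum, orthonormal2 s' &
  forall f : H -> K -> C, (forall k, linear_for *%R (f^~ k)) ->
    (forall h, linear_for *%R (f h)) ->
    \sum_(x <- s) f x.1 x.2 = \sum_(x <- s') f x.1 x.2.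
Proof.
elim: s => [|[h k] s [s1 on1 IH]]; first by exists [::].
pose r := k - \sum_(y <- s1) inner k y.2 *: y.2.
pose s2 := [seq (y.1 + inner k y.2 *: h, y.2) | y <- s1].
have on2 : orthonormal2 s2.
  rewrite /s2; elim: s1 on1 {IH r s2} => [|y s1 IH]//= [y1 ys1 /IH on1]; split=> //.
  by move=> z /mapP[w ws ->] /=; exact: ys1.
have expand (f : H -> K -> C) : (forall k, linear_for *%R (f^~ k)) ->
    (forall h, linear_for *%R (f h)) ->
    \sum_(x <- (h, k) :: s) f x.1 x.2 = f h r + \sum_(x <- s2) f x.1 x.2.
  move=> fl fr; rewrite big_cons (IH _ fl fr) /s2 big_map/=.
  have f0 h' : f h' 0 = 0.
    by have := fr h' (-1) 0 0; rewrite scaler0 addr0 mulN1r addNr.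
  have fsum' (t : fsum) : f h (\sum_(y <- t) inner k y.2 *: y.2) = \sum_(y <- t) inner k y.2 * f h y.2.
    by elim: t => [|y t IHt]; rewrite ?big_nil// !big_cons fr IHt.
  have -> : \sum_(y <- s1) f (y.1 + inner k y.2 *: h) y.2 =
      \sum_(y <- s1) inner k y.2 * f h y.2 + \sum_(y <- s1) f y.1 y.2.
    by rewrite -big_split/=; apply: eq_bigr => y _; rewrite (addrC y.1) fl.
  rewrite addrA; congr (_ + _); rewrite -fsum'.
  have := fr h 1 r (\sum_(y <- s1) inner k y.2 *: y.2).
  by rewrite scale1r subrK mul1r.
have ortho_aux (t : fsum) : orthonormal2 t -> forall z, z \in t ->
    inner (\sum_(y <- t) inner k y.2 *: y.2) z.2 = inner k z.2.
  elim: t => [|y t IHt] //= [y1 yt /IHt {}IHt] z; rewrite inE big_cons innerDl innerZl.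
  case/orP=> [/eqP ->|zt].
    rewrite y1 mulr1 inner_suml big_seq big1 ?addr0// => w wt.
    by rewrite innerZl (innerC w.2) yt// conjC0 mulr0.
  by rewrite IHt// yt// mulr0 add0r.
have rorth z : z \in s2 -> inner r z.2 = 0.
  move=> /mapP[w ws ->] /=; rewrite /r innerBl ortho_aux// subrr //.
have [r0|rn0] := eqVneq r 0.
  exists s2 => // f fl fr; rewrite expand// r0.
  by have := fr h (-1) 0 0; rewrite scaler0 addr0 mulN1r addNr => ->; rewrite add0r.
have nr0 : `|r| != 0 by rewrite normr_eq0.
exists ((`|r| *: h, `|r|^-1 *: r) :: s2) => [|f fl fr].
  split=> //= [|y ys]; last by rewrite innerZl rorth ?mulr0.
  rewrite innerZl innerZr -sqr_normE.
  have -> : (`|r|^-1)^* = `|r|^-1 by apply/CrealP; rewrite realV normr_real.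
  by rewrite expr2 mulKf// mulVf.
rewrite expand// big_cons/=; congr (_ + _).
have := fl (`|r|^-1 *: r) `|r| h 0; rewrite addr0 => ->.
have -> : f 0 (`|r|^-1 *: r) = 0.
  by have := fl (`|r|^-1 *: r) (-1) 0 0; rewrite scaler0 addr0 mulN1r addNr.
have := fr h `|r|^-1 r 0; rewrite !addr0 => ->.
have -> : f h 0 = 0 by have := fr h (-1) 0 0; rewrite scaler0 addr0 mulN1r addNr.
by rewrite addr0 mulrA mulfV// mul1r.
Qed.

End FormalSums.

Section FormalSumsMap.
Variables (R : realType) (H H' K : hilbertType R).
Local Notation C := R[i].

Definition fmap1 (T : H -> H') (s : fsum H K) : fsum H' K :=
  [seq (T x.1, x.2) | x <- s].

Lemma orthonormal2_fmap1 T s : orthonormal2 s -> orthonormal2 (fmap1 T s).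
Proof.
elim: s => [|x s IH]//= [x1 xs /IH on]; split=> // y /mapP[z zs ->] /=.
exact: xs.
Qed.

Lemma fform_orthonormal (s : fsum H K) : orthonormal2 s ->
  fform s s = \sum_(x <- s) inner x.1 x.1.
Proof.
elim: s => [|x s IH]; first by rewrite fform0 big_nil.
move=> /= [x1 xs on]; rewrite big_cons -IH// /fform !big_cons x1 mulr1 -!addrA.
congr (_ + _).
rewrite big_seq big1 => [|y ys]; last by rewrite xs// mulr0.
rewrite add0r [LHS]big_seq [RHS]big_seq; apply: eq_bigr => y ys; rewrite big_cons.
by rewrite (innerC y.2) xs// conjC0 mulr0 add0r.
Qed.

Lemma fform_fmap1 (T : {linear H -> H'}) s s' :
  (forall f : H -> K -> C, (forall k, linear_for *%R (f^~ k)) ->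
    (forall h, linear_for *%R (f h)) ->
    \sum_(x <- s) f x.1 x.2 = \sum_(x <- s') f x.1 x.2) ->
  fform (fmap1 T s) (fmap1 T s) = fform (fmap1 T s') (fmap1 T s').
Proof.
move=> ss'.
have half t : fform (fmap1 T s) t = fform (fmap1 T s') t.
  rewrite /fform !big_map; apply: (ss' (fun h k => \sum_(y <- t) inner (T h) y.1 * inner k y.2)).
    move=> k a h1 h2; rewrite mulr_sumr -big_split; apply: eq_bigr => y _.
    by rewrite linearP innerDl innerZl /= mulrDl mulrA.
  move=> h a k1 k2; rewrite mulr_sumr -big_split; apply: eq_bigr => y _.
  by rewrite innerDl innerZl mulrDr mulrCA.
by rewrite half fformC half -fformC.
Qed.

End FormalSumsMap.

Lemma fmap1_id (R : realType) (H K : hilbertType R) (s : fsum H K) :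
  fmap1 (idfun : H -> H) s = s.
Proof. by rewrite /fmap1 -[RHS]map_id; apply: eq_map => -[]. Qed.

Lemma fform_fmap1_le (R : realType) (H H' K : hilbertType R)
    (T : {linear H -> H'}) (M : R[i]) (s : fsum H K) :
  (forall h, `|T h| <= M * `|h|) ->
  fform (fmap1 T s) (fmap1 T s) <= M ^+ 2 * fform s s.
Proof.
move=> TM; have [s' on ss'] := gram_schmidt s.
rewrite (fform_fmap1 T ss') fform_orthonormal; last exact: orthonormal2_fmap1.
have -> : fform s s = fform s' s'.
  by rewrite -(fmap1_id s) -(fmap1_id s'); exact: (fform_fmap1 idfun ss').
rewrite fform_orthonormal// mulr_sumr big_map; apply: ler_sum => x _ /=.
rewrite -!sqr_normE -exprMn lerXn2r ?nnegrE//.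
exact: le_trans (TM x.1).
Qed.

Lemma fform_ge0 (R : realType) (H K : hilbertType R) (s : fsum H K) : 0 <= fform s s.
Proof.
have [s' on ss'] := gram_schmidt s.
rewrite -(fmap1_id s) (fform_fmap1 idfun ss') fmap1_id fform_orthonormal//.
by apply: sumr_ge0 => x _; rewrite -sqr_normE exprn_ge0.
Qed.

Record tensor_product (R : realType) (H K : hilbertType R) := TensorProduct {
  tensor_space : hilbertType R;
  tensor_map : {bilinear H -> K -> tensor_space};
  tensor_inner : forall h k h' k',
    inner (tensor_map h k) (tensor_map h' k') = inner h h' * inner k k';
  tensor_dense : closure [set \sum_(x <- s) tensor_map x.1 x.2 | s in @setT (seq (H * K))]
    = setT
}.

Lemma tensor_product_exists (R : realType) (H K : hilbertType R) : tensor_product H K.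
Proof.
have /cid[T /cid[i [iE idense]]] := @completion_exists R (fsum H K) [::] cat (@fscale R H K)
  (@fform R H K) (@fform0 R H K) (@fformD R H K) (@fformZ R H K) (@fformC R H K)
  (@fform_ge0 R H K).
pose t h k := i [:: (h, k)].
have tE h k h' k' : inner (t h k) (t h' k') = inner h h' * inner k k'.
  by rewrite iE /fform !big_seq1.
have itE s h k : inner (i s) (t h k) = \sum_(x <- s) inner (t x.1 x.2) (t h k).
  by rewrite iE /fform; apply: eq_bigr => x _; rewrite big_seq1 tE.
have isum s : i s = \sum_(x <- s) t x.1 x.2.
  apply/eqP; rewrite -subr_eq0; apply/eqP/inner_eq0.
  set d := _ - _; rewrite {2}/d innerBr inner_sumr.
  have e h k : inner d (t h k) = 0 by rewrite /d innerBl itE inner_suml subrr.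
  rewrite [X in _ - X]big1 => [|x _]; last exact: e.
  rewrite subr0 /d innerBl inner_suml iE; apply/eqP; rewrite subr_eq0; apply/eqP.
  by apply: eq_bigr => x _; rewrite iE /fform big_seq1.
have tl k : linear_for *:%R (t^~ k).
  move=> a h h'; apply/eqP; rewrite -subr_eq0; apply/eqP/inner_eq0.
  rewrite !(innerBl, innerBr, innerDl, innerDr, innerZl, innerZr) !tE.
  rewrite !(innerBl, innerBr, innerDl, innerDr, innerZl, innerZr); ring.
have tr h : linear_for *:%R (t h).
  move=> a k k'; apply/eqP; rewrite -subr_eq0; apply/eqP/inner_eq0.
  rewrite !(innerBl, innerBr, innerDl, innerDr, innerZl, innerZr) !tE.
  rewrite !(innerBl, innerBr, innerDl, innerDr, innerZl, innerZr); ring.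
pose tb := bilinear_isBilinear.Build R[i] H K T *:%R *:%R t (tl, tr).
pose b : {bilinear H -> K -> T} := HB.pack t tb.
exists T b => //.
apply/seteqP; split=> // x _ B.
rewrite -nbhs_ballE => -[e /= e0 eB].
have [s hs] := idense x _ e0; exists (i s); split; first by exists s => //; rewrite isum.
by apply: eB; rewrite -ball_normE.
Qed.

Definition tens (R : realType) (H K : hilbertType R) : hilbertType R :=
  tensor_space (tensor_product_exists H K).
Notation "H ⊗ K" := (tens H K) (at level 40, left associativity).

Definition tensv (R : realType) (H K : hilbertType R) :
  {bilinear H -> K -> H ⊗ K} := tensor_map (tensor_product_exists H K).

Record bounded_op (R : realType) (H K : hilbertType R) := BoundedOp {
  bop_linear :> {linear H -> K};
  bop_continuous : continuous bop_linear
}.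

(* [uadj U] is the adjoint of U, and the cancellation laws are U^* U = 1 and
   U U^* = 1. *)
Record unitary (R : realType) (H K : hilbertType R) := Unitary {
  uop :> bounded_op H K;
  uadj : bounded_op K H;
  uadjP : forall x y, inner (uop x) y = inner x (uadj y);
  uopK : cancel uop uadj;
  uadjK : cancel uadj uop
}.

Section OperatorExt.
Variables (R : realType) (H K : hilbertType R).

Lemma linear_ext (f g : {linear H -> K}) : f =1 g -> f = g.
Proof.
case: f => [f [[fm] [fs]]]; case: g => [g [[gm] [gs]]] /= /funext fg.
by subst g; rewrite (Prop_irrelevance fm gm) (Prop_irrelevance fs gs).
Qed.

Lemma bounded_op_ext (f g : bounded_op H K) : f =1 g -> f = g.
Proof.
case: f => f fc; case: g => g gc /= /linear_ext fg; subst g.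
by rewrite (Prop_irrelevance fc gc).
Qed.

End OperatorExt.

Section OperatorExt2.
Variables (R : realType) (H K : hilbertType R).

Lemma unitary_ext (U V : unitary H K) : U =1 V -> U = V.
Proof.
case: U => u u' h1 h2 h3; case: V => v v' k1 k2 k3 /= uv.
have e : u = v by exact: bounded_op_ext.
subst v; have e' : u' = v'.
  by apply: bounded_op_ext => y; rewrite -{1}(k3 y) h2.
by subst v'; congr Unitary; exact: Prop_irrelevance.
Qed.

Lemma bounded_opP (f : bounded_op H K) :
  exists2 M, 0 <= M & forall x, `|f x| <= M * `|x|.
Proof.
have : bounded_near f (nbhs (0 : H)).
  by apply: continuous_linear_bounded; exact: bop_continuous.
move/linear_boundedP => [M [Mr hM]]; exists (`|M| + 1); first by rewrite addr_ge0.
by apply: hM; rewrite (le_lt_trans (real_ler_norm Mr))// ltrDl.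
Qed.

Lemma bounded_continuous (f : {linear H -> K}) M :
  0 <= M -> (forall x, `|f x| <= M * `|x|) -> continuous f.
Proof.
move=> M0 fM; apply: bounded_linear_continuous; apply/linear_boundedP.
exists M; split=> [|r Mr x]; first exact: ger0_real.
by rewrite (le_trans (fM x))// ler_wpM2r// ltW.
Qed.
End OperatorExt2.

Section Extension.
Variables (R : realType) (H K : hilbertType R) (I : Type).
Variables (phi : I -> H) (psi : I -> K).
Local Notation C := R[i].

Definition lincomb (V : lmodType C) (f : I -> V) (s : seq (C * I)) : V :=
  \sum_(x <- s) x.1 *: f x.2.

Definition total_family (f : I -> H) :=
  forall x e, 0 < e -> exists s, `|x - lincomb f s| < e.

Definition lscale (a : C) (s : seq (C * I)) := [seq (a * x.1, x.2) | x <- s].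

Lemma lincomb_cat (V : lmodType C) (f : I -> V) s t :
  lincomb f (s ++ t) = lincomb f s + lincomb f t.
Proof. exact: big_cat. Qed.

Lemma lincombZ (V : lmodType C) (f : I -> V) a s :
  lincomb f (lscale a s) = a *: lincomb f s.
Proof.
rewrite /lincomb big_map scaler_sumr; apply: eq_bigr => x _.
by rewrite scalerA.
Qed.

Lemma extension_exists (M : C) : total_family phi -> 0 <= M ->
  (forall s, `|lincomb psi s| <= M * `|lincomb phi s|) ->
  exists F : bounded_op H K, (forall i, F (phi i) = psi i) /\
    (forall x, `|F x| <= M * `|x|).
Proof.
move=> tot M0 hM.
have hB s t : `|lincomb psi s - lincomb psi t| <= M * `|lincomb phi s - lincomb phi t|.
  by have := hM (s ++ lscale (-1) t); rewrite !lincomb_cat !lincombZ !scaleN1r.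
have small (x : K) (c : C) : 0 <= c -> (forall e, 0 < e -> `|x| <= c * e) -> x = 0.
  move=> c0 h; apply/eqP; rewrite -normr_eq0; apply/negPn/negP => n0.
  have e0 : 0 < `|x| by rewrite lt_def n0 normr_ge0.
  have c1 : 0 < (c + 1) * 2 by rewrite mulr_gt0// ltr_wpDl.
  have := h _ (divr_gt0 e0 c1); rewrite mulrCA -{1}(mulr1 `|x|) ler_pM2l//.
  rewrite ler_pdivlMr// mul1r => h1.
  have : c < (c + 1) * 2.
    by rewrite -subr_gt0 (_ : _ - _ = c + 2) ?ltr_wpDl//; ring.
  by move=> /lt_le_trans/(_ h1); rewrite ltxx.
have ex x : exists y, forall s, `|y - lincomb psi s| <= M * `|x - lincomb phi s|.
  have /choice[s hs] n : exists s, `|x - lincomb phi s| < n.+1%:R^-1.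
    by apply: tot; rewrite invr_gt0 ltr0n.
  have M1 : 0 < M + 1 by rewrite ltr_wpDl.
  have cau : cauchy ((fun n => lincomb psi (s n)) @ \oo).
    apply/cauchy_ballP => e e0; have [N hN] := invn_lt (lt_half (divr_gt0 e0 M1)).
    exists ([set lincomb psi (s n) | n in [set n | (N <= n)%N]],
            [set lincomb psi (s n) | n in [set n | (N <= n)%N]]).
      by split; exists N => // n /= leN; exists n.
    move=> [_ _] /= [[m /hN Nm <-] [n /hN Nn <-]]; rewrite -ball_normE/=.
    rewrite (le_lt_trans (hB _ _))//.
    have d : `|lincomb phi (s m) - lincomb phi (s n)| < e / (M + 1).
      rewrite -(subrK x (lincomb phi (s m))) -addrA (le_lt_trans (ler_normD _ _))//.
      rewrite (splitr (e / _)) ltrD//; last exact: lt_trans (hs _) _.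
      by rewrite distrC; exact: lt_trans (hs _) _.
    move: d; rewrite ltr_pdivlMr// mulrC; apply: le_lt_trans.
    by rewrite ler_wpM2r// lerDl.
  have /cvg_ex[y hy] : cvg ((fun n => lincomb psi (s n)) @ \oo) by exact: cauchy_cvg.
  exists y => t.
  have key e : 0 < e -> `|y - lincomb psi t| <= M * `|x - lincomb phi t| + (M + 1) * e.
    move=> e0; move/cvgrPdist_lt : hy => /(_ e e0)[N _ hN].
    have [N' hN'] := invn_lt e0; set n := maxn N N'.
    have h1 : `|y - lincomb psi (s n)| <= e by apply/ltW/hN; exact: leq_maxl.
    have h2 : `|x - lincomb phi (s n)| <= e.
      by apply/ltW/(lt_trans (hs _))/hN'; exact: leq_maxr.
    rewrite -(subrK (lincomb psi (s n)) y) -addrA (le_trans (ler_normD _ _))//.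
    have h3 := hB (s n) t.
    have h4 : `|lincomb phi (s n) - lincomb phi t| <= e + `|x - lincomb phi t|.
      rewrite -(subrK x (lincomb phi (s n))) -addrA (le_trans (ler_normD _ _))//.
      by rewrite lerD2r distrC.
    have h5 := le_trans h3 (ler_wpM2l M0 h4).
    rewrite (le_trans (lerD h1 h5))// le_eqVlt; apply/orP; left; apply/eqP; ring.
  have r1 : M * `|x - lincomb phi t| \is Num.real by rewrite ger0_real ?mulr_ge0.
  rewrite real_leNgt ?normr_real//; apply/negP => lt.
  have M2 : 0 < (M + 1) * 2 by rewrite mulr_gt0.
  have d0 : 0 < `|y - lincomb psi t| - M * `|x - lincomb phi t| by rewrite subr_gt0.
  have := key _ (divr_gt0 d0 M2).
  rewrite -lerBlDl (_ : (M + 1) * (_ / _) = (`|y - lincomb psi t| - M * `|x - lincomb phi t|) / 2); last first.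
    by field; rewrite gt_eqF.
  rewrite ler_pdivlMr// ger_pMr// => h; have : (1 : C) < 2 by rewrite ltr1n.
  by move=> /lt_le_trans/(_ h); rewrite ltxx.
have /choice[F hF] := ex.
have Flin : linear F.
  move=> a x y; apply/eqP; rewrite -subr_eq0; apply/eqP.
  have c0 : 0 <= M * (`|a| + 1) * 2 by rewrite !mulr_ge0// addr_ge0.
  apply: (small _ _ c0) => e e0.
  have [s hs] := tot x _ e0; have [t ht] := tot y _ e0.
  have h1 := hF (a *: x + y) (lscale a s ++ t).
  have h2 := le_trans (hF x s) (ler_wpM2l M0 (ltW hs)).
  have h3 := le_trans (hF y t) (ler_wpM2l M0 (ltW ht)).
  have h0 : `|a *: x + y - lincomb phi (lscale a s ++ t)| <= `|a| * e + e.
    rewrite lincomb_cat lincombZ opprD addrACA -scalerBr (le_trans (ler_normD _ _))//.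
    by rewrite normrZ lerD ?ler_wpM2l// ltW.
  have {}h1 := le_trans h1 (ler_wpM2l M0 h0).
  have -> : F (a *: x + y) - (a *: F x + F y) =
      (F (a *: x + y) - lincomb psi (lscale a s ++ t)) +
      (a *: (lincomb psi s - F x) + (lincomb psi t - F y)).
    by rewrite lincomb_cat lincombZ scalerBr [X in _ = _ + X]addrACA -opprD addrA subrK.
  rewrite (le_trans (ler_normD _ _))//.
  have h4 : `|a *: (lincomb psi s - F x) + (lincomb psi t - F y)| <= `|a| * (M * e) + M * e.
    by rewrite (le_trans (ler_normD _ _))// normrZ lerD ?ler_wpM2l// distrC.
  rewrite (le_trans (lerD h1 h4))// le_eqVlt; apply/orP; left; apply/eqP; ring.
pose Fl : {linear H -> K} := HB.pack F (GRing.isLinear.Build C H K *:%R F Flin).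
have Fb x : `|Fl x| <= M * `|x|.
  by have := hF x [::]; rewrite /lincomb !big_nil !subr0.
exists (BoundedOp (bounded_continuous M0 Fb)); split=> // i.
apply/eqP; rewrite -subr_eq0 -normr_eq0 eq_le normr_ge0 andbT.
have := hF (phi i) [:: (1, i)].
by rewrite /lincomb !big_seq1/= !scale1r subrr normr0 mulr0.
Qed.

Lemma total_ext (F G : bounded_op H K) : total_family phi ->
  (forall i, F (phi i) = G (phi i)) -> F = G.
Proof.
move=> tot FG; apply: bounded_op_ext => x.
have [M M0 FM] := bounded_opP F; have [M' M0' GM] := bounded_opP G.
have eqs s : F (lincomb phi s) = G (lincomb phi s).
  by rewrite /lincomb !linear_sum; apply: eq_bigr => y _; rewrite !linearZ/= FG.
apply/eqP; rewrite -subr_eq0 -normr_eq0; apply/negPn/negP => n0.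
have e0 : 0 < `|F x - G x| by rewrite lt_def n0 normr_ge0.
have c0 : 0 < M + M' + 1 by rewrite ltr_wpDl// addr_ge0.
have [s hs] := tot x _ (divr_gt0 e0 c0).
have : `|F x - G x| <= (M + M') * `|x - lincomb phi s|.
  have -> : F x - G x = F (x - lincomb phi s) - G (x - lincomb phi s).
    by rewrite !linearB/= eqs addrACA -opprD subrr subr0.
  by rewrite (le_trans (ler_normB _ _))// mulrDl lerD.
move: hs; rewrite ltr_pdivlMr// mulrC => h1 h2.
suff : `|F x - G x| < `|F x - G x| by rewrite ltxx.
by apply: le_lt_trans h1; apply: le_trans h2 _; rewrite ler_wpM2r// lerDl.
Qed.
End Extension.

Section Composition.
Variable R : realType.

Lemma id_continuous (H : hilbertType R) : continuous (idfun : {linear H -> H}).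
Proof. by move=> x; exact: cvg_id. Qed.

Definition bop_id (H : hilbertType R) : bounded_op H H := BoundedOp (@id_continuous H).

Lemma comp_continuous (H K L : hilbertType R) (f : bounded_op K L) (g : bounded_op H K) :
  continuous (f \o g : {linear H -> L}).
Proof.
by move=> x; apply: continuous_comp; exact: bop_continuous.
Qed.

Definition bop_comp (H K L : hilbertType R) (f : bounded_op K L) (g : bounded_op H K) :
  bounded_op H L := BoundedOp (@comp_continuous H K L f g).
End Composition.

Section Isometry.
Variables (R : realType) (H K : hilbertType R) (I : Type).
Variables (phi : I -> H) (psi : I -> K).

Lemma norm_inner (V : hilbertType R) (x : V) : `|x| = sqrtC (inner x x).
Proof. by rewrite -sqr_normE sqrCK. Qed.

Lemma total_inner_ext (x y : H) : total_family phi ->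
  (forall i, inner x (phi i) = inner y (phi i)) -> x = y.
Proof.
move=> tot xy.
have eqs s : inner (x - y) (lincomb phi s) = 0.
  rewrite inner_sumr big1// => z _; rewrite innerZr innerBl xy subrr mulr0//.
apply/eqP; rewrite -subr_eq0 -normr_eq0; apply/negPn/negP => n0.
have e0 : 0 < `|x - y| by rewrite lt_def n0 normr_ge0.
have [s hs] := tot (x - y) _ e0.
suff : `|x - y| <= `|x - y - lincomb phi s| by move=> /le_lt_trans/(_ hs); rewrite ltxx.
suff : `|x - y| ^+ 2 <= `|x - y - lincomb phi s| ^+ 2 by rewrite ler_pXn2r// ?nnegrE//.
rewrite [leLHS]sqr_normE sqr_normE.
move: (x - y) eqs => d eqs; rewrite innerBl [X in X - _]innerBr [X in _ - X]innerBr eqs.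
rewrite (innerC (lincomb _ _) d) eqs conjC0 subr0 sub0r opprK lerDl.
by rewrite -sqr_normE exprn_ge0.
Qed.

Hypothesis gram : forall i j, inner (phi i) (phi j) = inner (psi i) (psi j).

Lemma gram_norm s : `|lincomb psi s| = `|lincomb phi s|.
Proof.
rewrite !norm_inner; congr sqrtC; rewrite /lincomb !inner_suml.
apply: eq_bigr => x _; rewrite !inner_sumr; apply: eq_bigr => y _.
by rewrite !innerZl !innerZr gram.
Qed.
End Isometry.

(* Two total families with the same Gram matrix are unitarily equivalent. *)
Lemma unitary_exists (R : realType) (H K : hilbertType R) (I : Type)
    (phi : I -> H) (psi : I -> K) :
  total_family phi -> total_family psi ->
  (forall i j, inner (phi i) (phi j) = inner (psi i) (psi j)) ->
  exists U : unitary H K, forall i, U (phi i) = psi i.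
Proof.
move=> tphi tpsi gram.
have [||F [hF Fb]] := @extension_exists _ _ _ _ phi psi 1 tphi; first exact: ler01.
  by move=> s; rewrite mul1r (gram_norm gram).
have [||G [hG Gb]] := @extension_exists _ _ _ _ psi phi 1 tpsi; first exact: ler01.
  by move=> s; rewrite mul1r (gram_norm (fun i j => esym (gram i j))).
have GF x : G (F x) = x.
  have : bop_comp G F = bop_id H by apply: total_ext tphi _ => i /=; rewrite hF hG.
  by move=> /(congr1 (fun f : bounded_op H H => f x)).
have FG x : F (G x) = x.
  have : bop_comp F G = bop_id K by apply: total_ext tpsi _ => i /=; rewrite hG hF.
  by move=> /(congr1 (fun f : bounded_op K K => f x)).
have Fn x : inner (F x) (F x) = inner x x.
  rewrite -!sqr_normE; congr (_ ^+ 2); apply/eqP; rewrite eq_le.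
  by have := Fb x; have := Gb (F x); rewrite !mul1r GF => -> ->.
have FE x y : inner (F x) (F y) = inner x y.
  have h z : z^* * inner (F x) (F y) + z * (inner (F x) (F y))^* =
             z^* * inner x y + z * (inner x y)^*.
    have := Fn (x + z *: y); rewrite linearD linearZ/=.
    rewrite !(innerDl, innerDr, innerZl, innerZr) !Fn -!(innerC (F y)) -!(innerC y).
    by move=> e; apply: (addrI (inner x x + z * z^* * inner y y)); move: e => /eqP;
      rewrite -subr_eq0 => /eqP e; apply/eqP; rewrite -subr_eq0 -e; apply/eqP; ring.
  have h1 := h 1; have h2 := h 'i; rewrite conjCi in h2; rewrite conjC1 in h1.
  have ni : ('i : R[i]) != 0 by rewrite neq0Ci.
  apply: (mulfI (x := 'i * 2)); first by rewrite mulf_neq0// pnatr_eq0.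
  set c := inner _ _ in h1 h2 *; set d := inner _ _ in h1 h2 *.
  have -> : 'i * 2 * c = 'i * (1 * c + 1 * c^*) - (- 'i * c + 'i * c^*) by ring.
  by rewrite h1 h2; ring.
have adj x y : inner (F x) y = inner x (G y) by rewrite -{1}(FG y) FE.
by exists (@Unitary R H K F G adj GF FG).
Qed.

Section TensorTheory.
Variables (R : realType) (H K : hilbertType R).
Local Notation C := R[i].

Lemma inner_tensv (h h' : H) (k k' : K) :
  inner (tensv H K h k) (tensv H K h' k') = inner h h' * inner k k'.
Proof. exact: tensor_inner. Qed.

Lemma norm_tensv (h : H) (k : K) : `|tensv H K h k| = `|h| * `|k|.
Proof.
rewrite !norm_inner inner_tensv rootCMl// -sqr_normE exprn_ge0//.
Qed.

Lemma tensv_suml I (s : seq I) (F : I -> H) k :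
  tensv H K (\sum_(i <- s) F i) k = \sum_(i <- s) tensv H K (F i) k.
Proof.
by elim: s => [|i s IH]; rewrite ?big_nil ?linear0l// !big_cons linearDl IH.
Qed.

Lemma tensv_sumr I (s : seq I) (F : I -> K) h :
  tensv H K h (\sum_(i <- s) F i) = \sum_(i <- s) tensv H K h (F i).
Proof.
by elim: s => [|i s IH]; rewrite ?big_nil ?linear0r// !big_cons linearDr IH.
Qed.

Lemma tensor_approx (x : H ⊗ K) e : 0 < e ->
  exists s : seq (H * K), `|x - \sum_(y <- s) tensv H K y.1 y.2| < e.
Proof.
move=> e0; have : setT x by [].
rewrite -(tensor_dense (tensor_product_exists H K)) => /(_ (ball x e)).
case; first exact: nbhsx_ballx.
by move=> _ [[s _ <-]]; rewrite -ball_normE/= => ?; exists s.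
Qed.

Lemma total_tensv (I J : Type) (phi : I -> H) (psi : J -> K) :
  total_family phi -> total_family psi -> total_family (fun x : I * J => tensv H K (phi x.1) (psi x.2)).
Proof.
move=> tphi tpsi; set f := fun x : I * J => _.
have tensor_case (h : H) (k : K) e : 0 < e ->
    exists s, `|tensv H K h k - lincomb f s| < e.
  move=> e0; have k0 : 0 < `|k| + 1 by rewrite ltr_wpDl.
  have [s hs] := tphi h _ (divr_gt0 (lt_half e0) k0).
  set h' := lincomb phi s in hs; have h0 : 0 < `|h'| + 1 by rewrite ltr_wpDl.
  have [t ht] := tpsi k _ (divr_gt0 (lt_half e0) h0).
  exists [seq (x.1 * y.1, (x.2, y.2)) | x <- s, y <- t].
  have -> : lincomb f [seq (x.1 * y.1, (x.2, y.2)) | x <- s, y <- t] =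
            tensv H K h' (lincomb psi t).
    rewrite /lincomb big_allpairs_dep/= tensv_suml.
    apply: eq_bigr => x _; rewrite linearZl_LR tensv_sumr scaler_sumr.
    by apply: eq_bigr => y _; rewrite linearZr_LR scalerA.
  rewrite -(subrK (tensv H K h' k) (tensv H K h k)) -addrA -linearBl -linearBr.
  rewrite (le_lt_trans (ler_normD _ _))// !norm_tensv (splitr e) ltrD//.
    move: hs; rewrite ltr_pdivlMr//; apply: le_lt_trans.
    by rewrite ler_wpM2l// lerDl.
  move: ht; rewrite ltr_pdivlMr// mulrC; apply: le_lt_trans.
  by rewrite ler_wpM2r// lerDl.
move=> x e e0; have [s hs] := tensor_approx x (lt_half e0).
have [t ht] : exists t, `|\sum_(y <- s) tensv H K y.1 y.2 - lincomb f t| < e / 2.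
  have := lt_half e0; move: (e / 2) => d; elim: s {hs} d => [|y s IH] d d0.
    by exists [::]; rewrite /lincomb !big_nil subrr normr0.
  have [t1 h1] := tensor_case y.1 y.2 _ (lt_half d0).
  have [t2 h2] := IH _ (lt_half d0).
  exists (t1 ++ t2); rewrite big_cons lincomb_cat opprD addrACA.
  by rewrite (le_lt_trans (ler_normD _ _))// (splitr d) ltrD.
exists t; rewrite -(subrK (\sum_(y <- s) tensv H K y.1 y.2) x) -addrA.
by rewrite (le_lt_trans (ler_normD _ _))// (splitr e) ltrD.
Qed.

Lemma total_surj (I : Type) (phi : I -> H) : (forall x, exists i, phi i = x) -> total_family phi.
Proof.
move=> sphi x e e0; have [i ix] := sphi x; exists [:: (1, i)].
by rewrite /lincomb big_seq1 scale1r ix subrr normr0.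
Qed.

Lemma total_pure : total_family (fun x : H * K => tensv H K x.1 x.2).
Proof.
apply: (total_tensv (phi := id) (psi := id));
  by move=> x e e0; exists [:: (1, x)]; rewrite /lincomb big_seq1 scale1r subrr normr0.
Qed.

End TensorTheory.

Section TensorOperators.
Variable R : realType.
Local Notation C := R[i].

Lemma total_id (H : hilbertType R) : total_family (id : H -> H).
Proof. by apply: total_surj => x; exists x. Qed.

Lemma flip_exists (H K : hilbertType R) :
  exists U : unitary (H ⊗ K) (K ⊗ H),
    forall h k, U (tensv H K h k) = tensv K H k h.
Proof.
have [||x y|U hU] := @unitary_exists R _ _ (H * K) (fun x => tensv H K x.1 x.2)
  (fun x => tensv K H x.2 x.1).
- exact: total_pure.
- move=> x e e0; have [s hs] := total_pure x e0.
  exists [seq (z.1, (z.2.2, z.2.1)) | z <- s].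
  by rewrite /lincomb big_map.
- by rewrite !inner_tensv mulrC.
by exists U => h k; exact: (hU (h, k)).
Qed.

Lemma assoc_exists (H K L : hilbertType R) :
  exists U : unitary ((H ⊗ K) ⊗ L) (H ⊗ (K ⊗ L)),
    forall h k l, U (tensv (H ⊗ K) L (tensv H K h k) l) =
                  tensv H (K ⊗ L) h (tensv K L k l).
Proof.
have [||x y|U hU] := @unitary_exists R _ _ (H * K * L)
  (fun x => tensv (H ⊗ K) L (tensv H K x.1.1 x.1.2) x.2)
  (fun x => tensv H (K ⊗ L) x.1.1 (tensv K L x.1.2 x.2)).
- exact: (total_tensv (@total_pure _ H K) (@total_id L)).
- move=> x e e0; have [s hs] := total_tensv (@total_id H) (@total_pure _ K L) x e0.
  exists [seq (z.1, (z.2.1, z.2.2.1, z.2.2.2)) | z <- s].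
  by rewrite /lincomb big_map.
- by rewrite !inner_tensv mulrA.
by exists U => h k l; exact: (hU (h, k, l)).
Qed.

Lemma bop_tens1_exists (H H' K : hilbertType R) (f : bounded_op H H') :
  exists F : bounded_op (H ⊗ K) (H' ⊗ K),
    forall h k, F (tensv H K h k) = tensv H' K (f h) k.
Proof.
have [M M0 fM] := bounded_opP f.
have [|F [hF _]] := @extension_exists R _ _ (H * K) (fun x => tensv H K x.1 x.2)
  (fun x => tensv H' K (f x.1) x.2) M (@total_pure _ H K) M0; last first.
  by exists F => h k; exact: (hF (h, k)).
move=> s; pose t : fsum H K := [seq (x.1 *: x.2.1, x.2.2) | x <- s].
have sq (V : hilbertType R) (u : fsum V K) :
    `|\sum_(x <- u) tensv V K x.1 x.2| ^+ 2 = fform u u.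
  rewrite sqr_normE inner_suml; apply: eq_bigr => x _; rewrite inner_sumr.
  by apply: eq_bigr => y _; rewrite inner_tensv.
have -> : lincomb (fun x => tensv H K x.1 x.2) s = \sum_(x <- t) tensv H K x.1 x.2.
  by rewrite big_map; apply: eq_bigr => x _; rewrite linearZl_LR.
have -> : lincomb (fun x => tensv H' K (f x.1) x.2) s =
    \sum_(x <- fmap1 f t) tensv H' K x.1 x.2.
  by rewrite big_map big_map; apply: eq_bigr => x _ /=; rewrite linearZ linearZl_LR.
rewrite -(@ler_pXn2r _ 2)// ?nnegrE ?mulr_ge0// exprMn !sq.
exact: fform_fmap1_le.
Qed.

Lemma bop_tens_exists (H H' K K' : hilbertType R) (f : bounded_op H H') (g : bounded_op K K') :
  exists F : bounded_op (H ⊗ K) (H' ⊗ K'),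
    forall h k, F (tensv H K h k) = tensv H' K' (f h) (g k).
Proof.
have [F hF] := bop_tens1_exists K' f; have [G hG] := bop_tens1_exists H g.
have [S hS] := flip_exists H K; have [S' hS'] := flip_exists K' H.
exists (bop_comp F (bop_comp S' (bop_comp G S))) => h k /=.
by rewrite hS hG hS' hF.
Qed.

Lemma utens_exists (H H' K K' : hilbertType R) (U : unitary H H') (V : unitary K K') :
  exists W : unitary (H ⊗ K) (H' ⊗ K'),
    forall h k, W (tensv H K h k) = tensv H' K' (U h) (V k).
Proof.
have adjE (A B : hilbertType R) (X : unitary A B) x y : inner (X x) (X y) = inner x y.
  by rewrite uadjP uopK.
have tot (A B : hilbertType R) (X : unitary A B) : total_family X.
  by apply: total_surj => y; exists (uadj X y); rewrite uadjK.
have [||x y|W hW] := @unitary_exists R _ _ (H * K) (fun x => tensv H K x.1 x.2)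
  (fun x => tensv H' K' (U x.1) (V x.2)).
- exact: total_pure.
- exact: (total_tensv (@tot _ _ U) (@tot _ _ V)).
- by rewrite !inner_tensv !adjE.
by exists W => h k; exact: (hW (h, k)).
Qed.
End TensorOperators.

Section TensorOperatorDefs.
Variable R : realType.

Definition flip (H K : hilbertType R) : unitary (H ⊗ K) (K ⊗ H) :=
  projT1 (cid (flip_exists H K)).

Lemma flipE (H K : hilbertType R) h k : flip H K (tensv H K h k) = tensv K H k h.
Proof. exact: (projT2 (cid (flip_exists H K))). Qed.

Definition assoc (H K L : hilbertType R) :
    unitary ((H ⊗ K) ⊗ L) (H ⊗ (K ⊗ L)) :=
  projT1 (cid (assoc_exists H K L)).

Lemma assocE (H K L : hilbertType R) h k l :
  assoc H K L (tensv (H ⊗ K) L (tensv H K h k) l) =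
  tensv H (K ⊗ L) h (tensv K L k l).
Proof. exact: (projT2 (cid (assoc_exists H K L))). Qed.

Definition bop_tens (H H' K K' : hilbertType R)
    (f : bounded_op H H') (g : bounded_op K K') :
    bounded_op (H ⊗ K) (H' ⊗ K') :=
  projT1 (cid (bop_tens_exists f g)).

Lemma bop_tensE (H H' K K' : hilbertType R)
    (f : bounded_op H H') (g : bounded_op K K') h k :
  bop_tens f g (tensv H K h k) = tensv H' K' (f h) (g k).
Proof. exact: (projT2 (cid (bop_tens_exists f g))). Qed.

Definition utens (H H' K K' : hilbertType R) (U : unitary H H') (V : unitary K K') :
    unitary (H ⊗ K) (H' ⊗ K') :=
  projT1 (cid (utens_exists U V)).

Lemma utensE (H H' K K' : hilbertType R) (U : unitary H H') (V : unitary K K') h k :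
  utens U V (tensv H K h k) = tensv H' K' (U h) (V k).
Proof. exact: (projT2 (cid (utens_exists U V))). Qed.
End TensorOperatorDefs.

Section UnitaryGroupoid.
Variable R : realType.

Definition uid (H : hilbertType R) : unitary H H :=
  @Unitary R H H (bop_id H) (bop_id H) (fun _ _ => erefl) (fun _ => erefl)
    (fun _ => erefl).

Lemma ustar_adj (H K : hilbertType R) (U : unitary H K) x y :
  inner (uadj U x) y = inner x (U y).
Proof. by rewrite innerC -uadjP -innerC. Qed.

Definition ustar (H K : hilbertType R) (U : unitary H K) : unitary K H :=
  @Unitary R K H (uadj U) U (@ustar_adj H K U) (@uadjK _ _ _ U) (@uopK _ _ _ U).

Lemma ucomp_adj (H K L : hilbertType R) (U : unitary K L) (V : unitary H K) x y :
  inner (bop_comp U V x) y = inner x (bop_comp (uadj V) (uadj U) y).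
Proof. by rewrite /= !uadjP. Qed.

Lemma ucompK (H K L : hilbertType R) (U : unitary K L) (V : unitary H K) :
  cancel (bop_comp U V) (bop_comp (uadj V) (uadj U)).
Proof. by move=> x /=; rewrite !uopK. Qed.

Lemma uadj_compK (H K L : hilbertType R) (U : unitary K L) (V : unitary H K) :
  cancel (bop_comp (uadj V) (uadj U)) (bop_comp U V).
Proof. by move=> x /=; rewrite !uadjK. Qed.

Definition ucomp (H K L : hilbertType R) (U : unitary K L) (V : unitary H K) :
    unitary H L :=
  Unitary (ucomp_adj U V) (ucompK U V) (uadj_compK U V).
End UnitaryGroupoid.

Declare Scope unitary_scope.
Delimit Scope unitary_scope with U.
Bind Scope unitary_scope with unitary.
Notation "U * V" := (ucomp U V) : unitary_scope.
Notation "U ^*" := (ustar U) : unitary_scope.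
Notation "1" := (uid _) : unitary_scope.

(* Threefold tensor products are left-nested: A ⊗ B ⊗ C is (A ⊗ B) ⊗ C.  The
   operator X may map between different spaces, as the braiding c does. *)
Definition leg12 (R : realType) (A B A' B' C : hilbertType R)
    (X : unitary (A ⊗ B) (A' ⊗ B')) : unitary (A ⊗ B ⊗ C) (A' ⊗ B' ⊗ C) :=
  utens X 1.

Definition leg23 (R : realType) (A B C B' C' : hilbertType R)
    (X : unitary (B ⊗ C) (B' ⊗ C')) : unitary (A ⊗ B ⊗ C) (A ⊗ B' ⊗ C') :=
  (assoc A B' C')^* * utens 1 X * assoc A B C.

Definition leg13 (R : realType) (A B C A' C' : hilbertType R)
    (X : unitary (A ⊗ C) (A' ⊗ C')) : unitary (A ⊗ B ⊗ C) (A' ⊗ B ⊗ C') :=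
  leg23 A' (flip C' B) * leg12 B X * leg23 A (flip B C).

Arguments leg12 {R A B A' B' C} X.
Arguments leg23 {R A B C B' C'} X.
Arguments leg13 {R A B C A' C'} X.

Notation "X @12" := (leg12 X) (at level 8, format "X @12") : unitary_scope.
Notation "X @23" := (leg23 X) (at level 8, format "X @23") : unitary_scope.
Notation "X @13" := (leg13 X) (at level 8, format "X @13") : unitary_scope.

Local Open Scope unitary_scope.

Section BraidedMultiplicativeUnitary.
Variables (R : realType) (H L : hilbertType R).
Variables (W : unitary (H ⊗ H) (H ⊗ H)) (U : unitary (L ⊗ H) (L ⊗ H)).
Variables (V : unitary (H ⊗ L) (H ⊗ L)) (F : unitary (L ⊗ L) (L ⊗ L)).

Definition multiplicative_unitary :=
  W@23 * W@12 = W@12 * W@13 * W@23 :> unitary (H ⊗ H ⊗ H) _.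

Definition right_representation (K : hilbertType R)
    (S : unitary (K ⊗ H) (K ⊗ H)) :=
  W@23 * S@12 = S@12 * S@13 * W@23 :> unitary (K ⊗ H ⊗ H) _.

Definition braid_spec (K : hilbertType R) (S : unitary (K ⊗ H) (K ⊗ H))
    (Z : unitary (K ⊗ L) (K ⊗ L)) :=
  Z@13 = V@23 * S^*@12 * V^*@23 * S@12 :> unitary (K ⊗ H ⊗ L) _.

(* The unitary Z with [braid_spec S Z]; the value when there is none is junk. *)
Definition braid_unitary (K : hilbertType R) (S : unitary (K ⊗ H) (K ⊗ H)) :
    unitary (K ⊗ L) (K ⊗ L) :=
  if pselect (exists Z, braid_spec S Z) is left e then projT1 (cid e) else 1.

Definition braiding (K : hilbertType R) (S : unitary (K ⊗ H) (K ⊗ H)) :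
    unitary (L ⊗ K) (K ⊗ L) :=
  braid_unitary S * flip L K.

(* Only existence of Z is required: X |-> X@13 is injective as soon as H is
   nonzero, so that Z is then unique. *)
Record braided_multiplicative_unitary : Prop := {
  bmu_mult : multiplicative_unitary;
  bmu_rep : W@23 * U@12 = U@12 * U@13 * W@23 :> unitary (L ⊗ H ⊗ H) _;
  bmu_corep : V@23 * W@12 = W@12 * V@13 * V@23 :> unitary (H ⊗ H ⊗ L) _;
  bmu_Drinfeld : V@12 * W@13 * U@23 = U@23 * W@13 * V@12
    :> unitary (H ⊗ L ⊗ H) _;
  bmu_F_U : U@13 * U@23 * F@12 = F@12 * U@13 * U@23 :> unitary (L ⊗ L ⊗ H) _;
  bmu_F_V : V@13 * V@12 * F@23 = F@23 * V@13 * V@12 :> unitary (H ⊗ L ⊗ L) _;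
  bmu_braid : forall (K : hilbertType R) (S : unitary (K ⊗ H) (K ⊗ H)),
    right_representation S -> exists Z, braid_spec S Z;
  bmu_pentagon : F@23 * F@12 =
    F@12 * (braiding U)@23 * F@12 * (braiding U)^*@23 * F@23
    :> unitary (L ⊗ L ⊗ L) _
}.

Record rep_data := RepData {
  rep_space :> hilbertType R;
  rep_S : unitary (rep_space ⊗ H) (rep_space ⊗ H);
  rep_T : unitary (rep_space ⊗ L) (rep_space ⊗ L)
}.

Record rep_object (x : rep_data) : Prop := {
  rep_objectS : right_representation (rep_S x);
  rep_objectU : (rep_S x)@13 * U@23 * (rep_T x)@12 =
    (rep_T x)@12 * (rep_S x)@13 * U@23 :> unitary (x ⊗ L ⊗ H) _;
  rep_objectF : F@23 * (rep_T x)@12 =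
    (rep_T x)@12 * (braiding U)@23 * (rep_T x)@12 * (braiding U)^*@23 * F@23
    :> unitary (x ⊗ L ⊗ L) _
}.

Record rep_arrow (x y : rep_data) (a : bounded_op x y) : Prop := {
  rep_arrowS : bop_comp (bop_tens a (bop_id H)) (rep_S x) =
               bop_comp (rep_S y) (bop_tens a (bop_id H));
  rep_arrowT : bop_comp (bop_tens a (bop_id L)) (rep_T x) =
               bop_comp (rep_T y) (bop_tens a (bop_id L))
}.

Definition rep_tens (x y : rep_data) : rep_data :=
  @RepData (x ⊗ y) ((rep_S x)@13 * (rep_S y)@23)
    ((braiding (rep_S y))@23 * (rep_T x)@12 * (braiding (rep_S y))^*@23 *
     (rep_T y)@23).

(* tau(K); for an object x, tau(x) is [rep_trivial x] via the coercion. *)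
Definition rep_trivial (K : hilbertType R) : rep_data := @RepData K 1 1.

(* A is a total function on [rep_data], but every condition only concerns the
   objects of the category; the tensor product of two objects is an object. *)
Record natural_right_absorber (rho : rep_data)
    (A : forall x : rep_data, unitary (x ⊗ rho) (rep_trivial x ⊗ rho)) : Prop := {
  absorber_object : rep_object rho;
  absorber_arrow : forall x, rep_object x ->
    @rep_arrow (rep_tens x rho) (rep_tens (rep_trivial x) rho) (A x);
  absorber_natural : forall (x1 x2 : rep_data) (a : bounded_op x1 x2),
    rep_object x1 -> rep_object x2 -> rep_arrow a ->
    bop_comp (A x2) (bop_tens a (bop_id rho)) =
    bop_comp (bop_tens a (bop_id rho)) (A x1);
  absorber_tens : forall x1 x2 : rep_data, rep_object x1 -> rep_object x2 ->
    A (rep_tens x1 x2) = (A x1)@13 * (A x2)@23 :> unitary (x1 ⊗ x2 ⊗ rho) _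
}.
End BraidedMultiplicativeUnitary.

Arguments RepData {R H L} rep_space rep_S rep_T.

(* Main.v *)
Require Import Defs.
From mathcomp Require Import all_boot all_order all_algebra.
From mathcomp Require Import boolp reals.

(* For x = (K, S, T) the absorber on K ⊗ H ⊗ L is
   A^x = S_12 V_23^* T_13 V_23.  The braiding of L with (H, W) is V^* Σ, so the
   factor V_23^* T_13 V_23 is T_12 transported by this braiding; it commutes
   with the S-part of x ⊗ rho by the Drinfeld relation, and S_12 then absorbs S
   into W.  On the T-part, naturality of the braiding for the arrows F and
   c_{L,L} reduces the claim to the pentagon-like equation for T.  Naturality of
   A is immediate, and A^{x ⊗ y} = A^x_13 A^y_23 follows by inserting the formula
   Z_13 = V_23 S_12^* V_23^* S_12 for the braiding of L with y.

   Z is unique only if H is nonzero, which the T-part needs; if H = 0, then rho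
   is the zero space and there is nothing to prove. *)

Set Implicit Arguments.
Unset Strict Implicit.
Unset Printing Implicit Defensive.

Local Open Scope unitary_scope.

(** * Composition, adjoints and tensor products of unitaries *)

Section Groupoid.
Context {R : realType}.

Lemma ucompA (A B C D : hilbertType R) (X : unitary C D) (Y : unitary B C)
  (Z : unitary A B) : X * (Y * Z) = X * Y * Z.
Proof. exact: unitary_ext. Qed.

Lemma ucomp1l (A B : hilbertType R) (X : unitary A B) : 1 * X = X.
Proof. exact: unitary_ext. Qed.

Lemma ucomp1r (A B : hilbertType R) (X : unitary A B) : X * 1 = X.
Proof. exact: unitary_ext. Qed.

Lemma ustarK (A B : hilbertType R) (X : unitary A B) : X^*^* = X.
Proof. exact: unitary_ext. Qed.

Lemma ustarM (A B C : hilbertType R) (X : unitary B C) (Y : unitary A B) :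
  (X * Y)^* = Y^* * X^*.
Proof. exact: unitary_ext. Qed.

Lemma ustar1 (A : hilbertType R) : (1 : unitary A A)^* = 1.
Proof. exact: unitary_ext. Qed.

Lemma ucompV (A B : hilbertType R) (X : unitary A B) : X * X^* = 1.
Proof. by apply: unitary_ext => x; exact: uadjK. Qed.

Lemma ucompVl (A B : hilbertType R) (X : unitary A B) : X^* * X = 1.
Proof. by apply: unitary_ext => x; exact: uopK. Qed.

Lemma ucompK (A B C : hilbertType R) (X : unitary B C) (Y : unitary A B) :
  X * Y * Y^* = X.
Proof. by rewrite -ucompA ucompV ucomp1r. Qed.

Lemma ucompKV (A B C : hilbertType R) (X : unitary B C) (Y : unitary B A) :
  X * Y^* * Y = X.
Proof. by rewrite -ucompA ucompVl ucomp1r. Qed.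

Lemma uop_eq (A B : hilbertType R) (X Y : unitary A B) :
  uop X = uop Y -> X = Y.
Proof. by move=> e; apply: unitary_ext => x; rewrite e. Qed.

(** Pure tensors are total, and a bounded operator is determined by its values on a total family;
    the next three lemmas differ only in the bracketing. *)
Lemma tens_ext (A B Q : hilbertType R) (X Y : unitary (A ⊗ B) Q) :
  (forall a b, X (tensv A B a b) = Y (tensv A B a b)) -> X = Y.
Proof.
move=> h; apply: uop_eq; apply: total_ext (@total_pure _ A B) _ => -[a b].
exact: h.
Qed.

Lemma tens3_ext (A B C Q : hilbertType R) (X Y : unitary (A ⊗ B ⊗ C) Q) :
  (forall a b c, X (tensv (A ⊗ B) C (tensv A B a b) c) =
                 Y (tensv (A ⊗ B) C (tensv A B a b) c)) -> X = Y.
Proof.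
move=> h; apply: uop_eq.
apply: total_ext (total_tensv (@total_pure _ A B) (@total_id _ C)) _.
move=> [[a b] c]; exact: h.
Qed.

Lemma tens4_ext (A B C D Q : hilbertType R) (X Y : unitary (A ⊗ B ⊗ C ⊗ D) Q) :
  (forall a b c d,
     X (tensv (A ⊗ B ⊗ C) D (tensv (A ⊗ B) C (tensv A B a b) c) d) =
     Y (tensv (A ⊗ B ⊗ C) D (tensv (A ⊗ B) C (tensv A B a b) c) d)) -> X = Y.
Proof.
move=> h; apply: uop_eq; apply: total_ext (total_tensv (total_tensv
  (@total_pure _ A B) (@total_id _ C)) (@total_id _ D)) _.
move=> [[[a b] c] d]; exact: h.
Qed.

Lemma tens22_ext (A B C D Q : hilbertType R)
    (X Y : unitary (A ⊗ B ⊗ (C ⊗ D)) Q) :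
  (forall a b c d, X (tensv (A ⊗ B) (C ⊗ D) (tensv A B a b) (tensv C D c d)) =
     Y (tensv (A ⊗ B) (C ⊗ D) (tensv A B a b) (tensv C D c d))) -> X = Y.
Proof.
move=> h; apply: uop_eq.
apply: total_ext (total_tensv (@total_pure _ A B) (@total_pure _ C D)) _.
move=> [[a b] [c d]]; exact: h.
Qed.

Lemma utensM (A B C A' B' C' : hilbertType R) (X : unitary B C)
    (Y : unitary A B) (X' : unitary B' C') (Y' : unitary A' B') :
  utens (X * Y) (X' * Y') = utens X X' * utens Y Y'.
Proof. by apply: tens_ext => a a'; rewrite /= !utensE. Qed.

Lemma utens1 (A B : hilbertType R) :
  utens (1 : unitary A A) (1 : unitary B B) = 1.
Proof. by apply: tens_ext => a b; rewrite utensE. Qed.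

Lemma utensV (A B A' B' : hilbertType R) (X : unitary A B)
    (Y : unitary A' B') : (utens X Y)^* = utens X^* Y^*.
Proof.
rewrite -[RHS]ucomp1l -(ucompVl (utens X Y)) -ucompA -utensM !ucompV utens1.
by rewrite ucomp1r.
Qed.

Lemma assocVE (A B C : hilbertType R) a b c :
  uadj (assoc A B C) (tensv A (B ⊗ C) a (tensv B C b c)) =
  tensv (A ⊗ B) C (tensv A B a b) c.
Proof. by rewrite -assocE uopK. Qed.

Lemma flipV (A B : hilbertType R) : (flip A B)^* = flip B A.
Proof.
apply: tens_ext => b a; rewrite flipE.
by apply: (can_inj (uopK (flip A B))); rewrite flipE; exact: uadjK.
Qed.

Lemma flip_utens (A B A' B' : hilbertType R) (X : unitary A A')
    (Y : unitary B B') : flip A' B' * utens X Y = utens Y X * flip A B.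
Proof. by apply: tens_ext => a b; rewrite /= utensE !flipE utensE. Qed.

End Groupoid.

(** * Operators acting on one tensor factor of a larger space *)

Section Place.
Context {R : realType}.

(** The frame [t] exhibits $M$ as a tensor factor of $Q$ with complement $N$. For endomorphisms, leg
    notation becomes an instance of this, and comparing legs amounts to comparing frames. *)
Definition place_def (M N Q : hilbertType R) (t : unitary (M ⊗ N) Q)
  (X : unitary M M) : unitary Q Q := t * utens X 1 * t^*.

Fact place_key : unit. Proof. by []. Qed.

(* Locked, so that rewriting with ucompA does not see the product in it. *)
Definition place := locked_with place_key place_def.

Lemma placeE (M N Q : hilbertType R) (t : unitary (M ⊗ N) Q) X :
  place t X = t * utens X 1 * t^*.
Proof. by rewrite /place unlock. Qed.

Lemma placeM (M N Q : hilbertType R) (t : unitary (M ⊗ N) Q) X Y :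
  place t (X * Y) = place t X * place t Y.
Proof.
by rewrite !placeE -{1}(ucomp1l (B:=N) 1) utensM !ucompA ucompKV.
Qed.

Lemma placeV (M N Q : hilbertType R) (t : unitary (M ⊗ N) Q) X :
  place t X^* = (place t X)^*.
Proof. by rewrite !placeE !ustarM ustarK utensV ustar1 ucompA. Qed.

(** For $n\ne0$, $\|(Xm-Ym)\otimes n\|=\|Xm-Ym\|\,\|n\|$, so $X\otimes1$ determines $X$. *)
Lemma place_inj (M N Q : hilbertType R) (t : unitary (M ⊗ N) Q) X Y :
  (exists n : N, n <> 0%R) -> place t X = place t Y -> X = Y.
Proof.
move=> [n n0] e; have {}e : utens X (1 : unitary N N) = utens Y 1.
  have := congr1 (fun Z => t^* * Z * t) e.
  by rewrite !placeE !ucompA !ucompKV ucompVl !ucomp1l.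
apply: unitary_ext => m; apply: GRing.subr0_eq.
have := congr1 (fun Z => uop Z (tensv M N m n)) e; rewrite /= !utensE => /eqP.
rewrite -GRing.subr_eq0 -linearBl => /eqP/(congr1 Num.norm).
rewrite norm_tensv Num.Theory.normr0 => /eqP; rewrite GRing.mulf_eq0.
by case/orP=> /eqP/Num.Theory.normr0_eq0 // /n0.
Qed.

(** Conjugation by $1\otimes r$ preserves the form $X\otimes1$: the presentation of the complement
    is immaterial. *)
Lemma place_change (M N N' Q : hilbertType R) (t : unitary (M ⊗ N) Q)
    (r : unitary N' N) X : place (t * utens 1 r) X = place t X.
Proof.
rewrite !placeE ustarM !ucompA; congr (_ * _).
rewrite utensV ustar1 -!(ucompA t) -!utensM.
by rewrite ucomp1l !ucomp1r ucompV.
Qed.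

Lemma place_conj (M N Q Q' : hilbertType R) (u : unitary Q Q')
    (t : unitary (M ⊗ N) Q) X : u * place t X * u^* = place (u * t) X.
Proof. by rewrite !placeE ustarM !ucompA. Qed.

Lemma place_place (M N N' Q Q' : hilbertType R) (t : unitary (Q ⊗ N') Q')
    (u : unitary (M ⊗ N) Q) X :
  place t (place u X) = place (t * utens u 1 * (assoc M N N')^*) X.
Proof.
have e : utens X (1 : unitary (N ⊗ N') (N ⊗ N')) * assoc M N N' =
    assoc M N N' * utens (utens X 1) 1.
  rewrite -utens1; apply: tens3_ext => m n n'.
  by rewrite /= !(assocE, utensE).
rewrite !placeE !ustarM utensV ustarK ustar1 !ucompA -(ucompA _ _ (assoc _ _ _)).
rewrite -(ucompA _ (assoc _ _ _)^*) e !ucompA ucompKV.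
by rewrite -!(ucompA t) -!utensM !ucomp1l.
Qed.

(** The flip exchanges factor and complement, so this is the commutation of $X\otimes1$ with
    $1\otimes Y$. *)
Lemma place_comm (M N Q : hilbertType R) (t : unitary (M ⊗ N) Q) X Y :
  place t X * place (t * flip N M) Y = place (t * flip N M) Y * place t X.
Proof.
have -> : place (t * flip N M) Y = t * utens 1 Y * t^*.
  rewrite !placeE ustarM flipV !ucompA -(ucompA t) flip_utens !ucompA.
  by rewrite -(flipV M N) ucompKV.
rewrite !placeE !ucompA !ucompKV -!(ucompA t) -!utensM.
by rewrite !ucomp1l !ucomp1r.
Qed.

Lemma leg12_place (A B C : hilbertType R) (X : unitary (A ⊗ B) (A ⊗ B)) :
  leg12 X = place (1 : unitary (A ⊗ B ⊗ C) _) X.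
Proof. by rewrite !placeE ucomp1l ustar1 ucomp1r. Qed.

Lemma leg23_place (A B C : hilbertType R) (X : unitary (B ⊗ C) (B ⊗ C)) :
  leg23 X = place ((assoc A B C)^* * flip (B ⊗ C) A) X.
Proof.
rewrite !placeE ustarM ustarK -(ucompA _ (flip _ _)) flip_utens flipV.
by rewrite !ucompA -(flipV A) ucompKV.
Qed.

Lemma leg23M (A B C B' C' B'' C'' : hilbertType R)
    (X : unitary (B' ⊗ C') (B'' ⊗ C'')) (Y : unitary (B ⊗ C) (B' ⊗ C')) :
  leg23 (A := A) (X * Y) = X@23 * Y@23.
Proof.
by rewrite /leg23 -{1}(ucomp1l (B:=A) 1) utensM !ucompA ucompK.
Qed.

Lemma leg23V (A B C B' C' : hilbertType R) (X : unitary (B ⊗ C) (B' ⊗ C')) :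
  leg23 (A := A) X^* = X@23^*.
Proof. by rewrite /leg23 !ustarM utensV ustarK ustar1 ucompA. Qed.

Lemma leg13_place (A B C : hilbertType R) (X : unitary (A ⊗ C) (A ⊗ C)) :
  leg13 (B := B) X = place (leg23 (flip C B)) X.
Proof. by rewrite /leg13 !placeE -leg23V flipV. Qed.

End Place.

(** * Frames for two or three of four legs *)

Section FourLegFrames.
Context {R : realType}.
Implicit Types A B C D : hilbertType R.

(* The first two (or three) factors go to the legs in the name, the other ones
   to the remaining legs in increasing order. *)
Definition frame12 A B C D : unitary (A ⊗ B ⊗ (C ⊗ D)) (A ⊗ B ⊗ C ⊗ D) :=
  (assoc (A ⊗ B) C D)^*.

Definition frame13 A B C D : unitary (A ⊗ C ⊗ (B ⊗ D)) (A ⊗ B ⊗ C ⊗ D) :=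
  leg12 (leg23 (flip C B)) * frame12 A C B D.

Definition frame14 A B C D : unitary (A ⊗ D ⊗ (B ⊗ C)) (A ⊗ B ⊗ C ⊗ D) :=
  leg23 (flip D C) * frame13 A B D C.

Definition frame124 A B C D : unitary (A ⊗ B ⊗ D ⊗ C) (A ⊗ B ⊗ C ⊗ D) :=
  leg23 (flip D C).

Definition frame134 A B C D : unitary (A ⊗ C ⊗ D ⊗ B) (A ⊗ B ⊗ C ⊗ D) :=
  leg12 (leg23 (flip C B)) * frame124 A C B D.

Definition frame234 A B C D : unitary (B ⊗ C ⊗ D ⊗ A) (A ⊗ B ⊗ C ⊗ D) :=
  leg12 (assoc A B C)^* * (assoc A (B ⊗ C) D)^* * flip (B ⊗ C ⊗ D) A.

(** Obtained by a flip from the frame of the complementary legs, as are the next two, so that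
    [place_comm] applies to disjoint pairs of legs. *)
Definition frame23 A B C D : unitary (B ⊗ C ⊗ (A ⊗ D)) (A ⊗ B ⊗ C ⊗ D) :=
  frame14 A B C D * flip (B ⊗ C) (A ⊗ D).

Definition frame24 A B C D : unitary (B ⊗ D ⊗ (A ⊗ C)) (A ⊗ B ⊗ C ⊗ D) :=
  frame13 A B C D * flip (B ⊗ D) (A ⊗ C).

Definition frame34 A B C D : unitary (C ⊗ D ⊗ (A ⊗ B)) (A ⊗ B ⊗ C ⊗ D) :=
  frame12 A B C D * flip (C ⊗ D) (A ⊗ B).

Definition frame123 A B C D : unitary (A ⊗ B ⊗ C ⊗ D) (A ⊗ B ⊗ C ⊗ D) := 1.

End FourLegFrames.

Notation on12 := (place (frame12 _ _ _ _)).
Notation on13 := (place (frame13 _ _ _ _)).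
Notation on14 := (place (frame14 _ _ _ _)).
Notation on23 := (place (frame23 _ _ _ _)).
Notation on24 := (place (frame24 _ _ _ _)).
Notation on34 := (place (frame34 _ _ _ _)).
Notation on123 := (place (frame123 _ _ _ _)).
Notation on124 := (place (frame124 _ _ _ _)).
Notation on134 := (place (frame134 _ _ _ _)).
Notation on234 := (place (frame234 _ _ _ _)).

Section FourLegs.
Context {R : realType} {A B C D : hilbertType R}.
Local Notation Q := (A ⊗ B ⊗ C ⊗ D).

Lemma on12_34C X Y : on12 X * on34 Y = on34 Y * on12 X
  :> unitary Q Q.
Proof. exact: place_comm. Qed.
Lemma on13_24C X Y : on13 X * on24 Y = on24 Y * on13 X
  :> unitary Q Q.
Proof. exact: place_comm. Qed.
Lemma on14_23C X Y : on14 X * on23 Y = on23 Y * on14 X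
  :> unitary Q Q.
Proof. exact: place_comm. Qed.

(** Once the same operator is placed on both sides, only the frames remain to be compared. The
    variant [swapped_frame] is for frames that list the complementary legs in opposite orders. *)
Ltac same_frame := congr place; apply: tens22_ext => a b c d;
  do !rewrite /= (assocE, assocVE, utensE, flipE) //=.
Ltac swapped_frame := rewrite -(place_change _ (flip _ _)); same_frame.

Lemma on123_12 X : on123 X@12 = on12 X :> unitary Q Q.
Proof. rewrite leg12_place place_place; same_frame. Qed.
Lemma on123_13 X : on123 X@13 = on13 X :> unitary Q Q.
Proof. rewrite leg13_place place_place; same_frame. Qed.
Lemma on123_23 X : on123 X@23 = on23 X :> unitary Q Q.
Proof. rewrite leg23_place place_place; same_frame. Qed.
Lemma on124_12 X : on124 X@12 = on12 X :> unitary Q Q.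
Proof. rewrite leg12_place place_place; swapped_frame. Qed.
Lemma on124_13 X : on124 X@13 = on14 X :> unitary Q Q.
Proof. rewrite leg13_place place_place; same_frame. Qed.
Lemma on124_23 X : on124 X@23 = on24 X :> unitary Q Q.
Proof. rewrite leg23_place place_place; same_frame. Qed.
Lemma on134_12 X : on134 X@12 = on13 X :> unitary Q Q.
Proof. rewrite leg12_place place_place; swapped_frame. Qed.
Lemma on134_13 X : on134 X@13 = on14 X :> unitary Q Q.
Proof. rewrite leg13_place place_place; swapped_frame. Qed.
Lemma on134_23 X : on134 X@23 = on34 X :> unitary Q Q.
Proof. rewrite leg23_place place_place; same_frame. Qed.
Lemma on234_12 X : on234 X@12 = on23 X :> unitary Q Q.
Proof. rewrite leg12_place place_place; swapped_frame. Qed.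
Lemma on234_13 X : on234 X@13 = on24 X :> unitary Q Q.
Proof. rewrite leg13_place place_place; swapped_frame. Qed.
Lemma on234_23 X : on234 X@23 = on34 X :> unitary Q Q.
Proof. rewrite leg23_place place_place; swapped_frame. Qed.

End FourLegs.

(** * Passage between three legs, one of them composite, and four legs *)

Section Grouping.
Context {R : realType}.

Lemma place_conj_arg (M M' N Q : hilbertType R) (t : unitary (M ⊗ N) Q)
    (u : unitary M' M) X : place t (u * X * u^*) = place (t * utens u 1) X.
Proof.
rewrite !placeE !ustarM utensV ustar1 !ucompA -!(ucompA t) -!utensM.
by rewrite !ucomp1l.
Qed.

Lemma place1 (M N Q : hilbertType R) (t : unitary (M ⊗ N) Q) : place t 1 = 1.
Proof. by rewrite !placeE utens1 ucomp1r ucompV. Qed.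

Lemma leg12_1 (A B C : hilbertType R) :
  leg12 (1 : unitary (A ⊗ B) (A ⊗ B)) = (1 : unitary (A ⊗ B ⊗ C) _).
Proof. exact: utens1. Qed.

Lemma leg13_1 (A B C : hilbertType R) :
  leg13 (1 : unitary (A ⊗ C) (A ⊗ C)) = (1 : unitary (A ⊗ B ⊗ C) _).
Proof. by rewrite leg13_place place1. Qed.

Lemma leg12V (A B C A' B' : hilbertType R) (X : unitary (A ⊗ B) (A' ⊗ B')) :
  leg12 (C := C) X^* = X@12^*.
Proof. by rewrite /leg12 utensV ustar1. Qed.

Lemma leg13V (A B C : hilbertType R) (X : unitary (A ⊗ C) (A ⊗ C)) :
  leg13 (B := B) X^* = X@13^*.
Proof. by rewrite !leg13_place placeV. Qed.

Lemma leg12M (A B C A' B' A'' B'' : hilbertType R)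
    (X : unitary (A' ⊗ B') (A'' ⊗ B'')) (Y : unitary (A ⊗ B) (A' ⊗ B')) :
  leg12 (C := C) (X * Y) = X@12 * Y@12.
Proof. by rewrite /leg12 -{1}(ucomp1l (B:=C) 1) utensM. Qed.

Context {A B C D : hilbertType R}.
Local Notation Q := (A ⊗ B ⊗ C ⊗ D).

(** The product is read here with first leg $A\otimes B$, so that legs 1 and 2 of three comprise
    legs 1, 2, 3 of four; likewise in the next two lemmas. *)
Lemma leg12_on123 X : X@12 = on123 X :> unitary Q Q.
Proof. exact: leg12_place. Qed.

Lemma leg13_on124 X : X@13 = on124 X :> unitary Q Q.
Proof. exact: leg13_place. Qed.

Lemma leg23_on34 X : X@23 = on34 X :> unitary Q Q.
Proof. exact: leg23_place. Qed.

(** Serves when the carrier of $\rho$ is the middle leg, as in the arrow conditions; [regroup34]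
    serves when it is the last one, as in condition (ii). *)
Definition regroup23 : unitary (A ⊗ (B ⊗ C) ⊗ D) Q := leg12 (assoc A B C)^*.

Definition regroup34 : unitary (A ⊗ B ⊗ (C ⊗ D)) Q := (assoc (A ⊗ B) C D)^*.

Lemma regroup23_leg23 X : regroup23 * X@23 * regroup23^* = on234 X.
Proof. by rewrite leg23_place place_conj ucompA. Qed.

Lemma regroup23_leg13 X : regroup23 * X@13 * regroup23^* = on14 X.
Proof.
rewrite leg13_place place_conj; congr place; apply: tens22_ext => a b c d.
by do !rewrite /= (assocE, assocVE, utensE, flipE) //=.
Qed.

Lemma regroup23_leg12 X :
  regroup23 * (assoc A B C * X * (assoc A B C)^*)@12 * regroup23^* = on123 X.
Proof.
rewrite -leg12_on123 /regroup23 -leg12V -!leg12M ustarK !ucompA ucompVl.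
by rewrite ucomp1l ucompKV.
Qed.

Lemma regroup34_leg13 X :
  regroup34 * (assoc A C D * X * (assoc A C D)^*)@13 * regroup34^* = on134 X.
Proof.
rewrite leg13_place place_conj place_conj_arg; congr place.
apply: tens4_ext => a c d b.
by do !rewrite /= (assocE, assocVE, utensE, flipE) //=.
Qed.

Lemma regroup34_leg23 X :
  regroup34 * (assoc B C D * X * (assoc B C D)^*)@23 * regroup34^* = on234 X.
Proof.
rewrite leg23_place place_conj place_conj_arg; congr place.
apply: tens4_ext => b c d a.
by do !rewrite /= (assocE, assocVE, utensE, flipE) //=.
Qed.

End Grouping.

Section Braiding.
Context {R : realType}.

(** The flips in $c=Z\Sigma$ turn $T_{12}$ into $T_{13}$. Only endomorphisms remain, so that frames
    apply. *)
Lemma braid_conj (A K L : hilbertType R) (Z : unitary (K ⊗ L) (K ⊗ L))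
    (T : unitary (A ⊗ L) (A ⊗ L)) :
  (Z * flip L K)@23 * T@12 * (Z * flip L K)^*@23 = Z@23 * T@13 * Z^*@23.
Proof. by rewrite ustarM flipV !leg23M /leg13 !ucompA. Qed.

End Braiding.

(** * Relations between unitaries of a single space, with legs kept only in the names *)

Section GroupIdentities.
Context {R : realType} {Q : hilbertType R}.
Implicit Types X Y Z P : unitary Q Q.

Lemma ucomp_eq X Y Z P : X * Y = Z * P -> forall S : unitary Q Q,
  S * X * Y = S * Z * P.
Proof. by move=> e S; rewrite -ucompA e ucompA. Qed.

Lemma commV X Y : X * Y = Y * X -> X^* * Y = Y * X^*.
Proof.
by move=> e; rewrite -[LHS](ucompK _ X) -(ucompA X^*) -e ucompA ucompVl ucomp1l.
Qed.

Lemma commVr X Y : X * Y = Y * X -> X * Y^* = Y^* * X.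
Proof. by move=> e; rewrite -commV. Qed.

Lemma swapV X Y Z : X * Z = Z * Y -> Z^* * X = Y * Z^*.
Proof.
by move=> e; rewrite -[LHS](ucompK _ Z) -(ucompA Z^*) e ucompA ucompVl ucomp1l.
Qed.

(** Leg 3 is auxiliary. The second relation gives $V_{14}V_{34}=W_{13}^{*}V_{34}W_{13}$; the
    Drinfeld relation, used once with $U_{23}^{*}$ and once with $U_{23}$, exchanges $V_{12}$ and
    the inner $W_{13}$; since $W_{13}$ commutes with $Z_{24}$, it finally cancels against
    $W_{13}^{*}$. *)
Lemma yang_baxter_group (V12 V14 V34 U23 W13 : unitary Q Q) :
  V12 * W13 * U23 = U23 * W13 * V12 -> V34 * W13 = W13 * V14 * V34 ->
  V12 * V34 = V34 * V12 -> V14 * U23 = U23 * V14 ->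
  let Z24 := V34 * U23^* * V34^* * U23 in
  W13 * Z24 = Z24 * W13 ->
  V14 * V12 * Z24 = Z24 * V12 * V14.
Proof.
move=> dr co c1 c2 /= c3.
have a : V14 * V34 = W13^* * V34 * W13.
  by rewrite -ucompA co !ucompA ucompVl ucomp1l.
have b : W13 * V12 * U23^* = U23^* * V12 * W13.
  by rewrite -[RHS]ucompA; apply/esym/swapV; rewrite dr ucompA.
have c : V34^* * W13 * V14 = W13 * V34^*.
  by rewrite -ucompA; apply: swapV; rewrite -co.
rewrite !ucompA (ucomp_eq c1) a -(ucompA (_ * _) W13) -(ucompA (_ * _) (_ * _)) b.
rewrite !ucompA -(ucompA _ W13) -c !ucompA (ucomp_eq (commVr c1)).
have dr' : V12 * (W13 * U23) = U23 * (W13 * V12) by rewrite !ucompA.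
rewrite (ucomp_eq c2) -(ucompA _ W13 U23) (ucomp_eq dr') !ucompA.
congr (_ * _ * _).
by rewrite -!(ucompA W13^*) -c3 ucompA ucompVl ucomp1l.
Qed.

End GroupIdentities.

Section AbsorberIdentities.
Context {R : realType} {Q : hilbertType R}.

(** By the second relation $V_{23}$ passes to the right, leaving $V_{24}^{*}$ and $V_{24}$ outside
    $Z_{34}T_{14}Z_{34}^{*}$. The third relation then contracts $T_{13}Z_{34}T_{14}Z_{34}^{*}F_{34}$
    to $F_{34}T_{13}$, and the first carries $F_{34}$ past the factors $V$. *)
Lemma absorber_T_group (S12 V23 V24 T13 T14 Z34 F34 : unitary Q Q) :
  V24 * V23 * F34 = F34 * V24 * V23 -> V24 * V23 * Z34 = Z34 * V23 * V24 ->
  F34 * T13 = T13 * Z34 * T14 * Z34^* * F34 ->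
  V23 * T14 = T14 * V23 -> T13 * V24 = V24 * T13 -> S12 * F34 = F34 * S12 ->
  S12 * V23^* * T13 * V23 * (Z34 * V24^* * T14 * V24 * Z34^* * F34) =
  F34 * (S12 * V23^* * T13 * V23).
Proof.
move=> h1 h2 h3 c1 c2 c3.
have e1 : V23 * (Z34 * V24^*) = V24^* * Z34 * V23.
  by rewrite ucompA -[RHS]ucompA; apply/esym/swapV; rewrite ucompA -h2.
have e2 : V23 * (V24 * Z34^*) = Z34^* * V24 * V23.
  by rewrite ucompA -[RHS]ucompA; apply/esym/swapV; rewrite ucompA -h2.
have e3 : V23^* * V24^* * F34 = F34 * V23^* * V24^*.
  by rewrite -ustarM -[RHS]ucompA -ustarM; apply: commV; rewrite ucompA.
rewrite !ucompA -(ucompA _ Z34) -(ucompA _ V23) e1 !ucompA (ucomp_eq c1).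
rewrite -(ucompA _ V24) -(ucompA _ V23) e2 !ucompA.
rewrite -(ucompA _ V24) -(ucompA _ _ F34) h1 !ucompA (ucomp_eq (commVr c2)).
rewrite -(ucompA _ T13) -(ucompA _ (T13 * _)) -(ucompA _ _ Z34^*).
rewrite -(ucompA _ _ F34) -h3 !ucompA (ucomp_eq c2).
rewrite -(ucompA S12 V23^*) -(ucompA S12 _ F34) e3.
by rewrite !ucompA c3 ucompKV.
Qed.

(** The Drinfeld relation for $V_{23}$ turns $W_{24}U_{34}$ into $U_{34}W_{24}$, which lets $T_{13}$
    pass $S_{14}U_{34}$; for $V_{23}^{*}$ it restores the order, so that
    $S_{12}S_{14}W_{24}=W_{24}S_{12}$ applies. *)
Lemma absorber_S_group (S12 S14 V23 W24 U34 T13 : unitary Q Q) :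
  W24 * S12 = S12 * S14 * W24 -> V23 * W24 * U34 = U34 * W24 * V23 ->
  S14 * U34 * T13 = T13 * S14 * U34 ->
  V23 * S14 = S14 * V23 -> T13 * W24 = W24 * T13 -> S12 * U34 = U34 * S12 ->
  S12 * V23^* * T13 * V23 * (S14 * (W24 * U34)) =
  W24 * U34 * (S12 * V23^* * T13 * V23).
Proof.
move=> h1 h2 h3 c1 c2 c3.
have h2' : V23 * (W24 * U34) = U34 * W24 * V23 by rewrite ucompA.
have h3' : T13 * (S14 * U34) = S14 * U34 * T13 by rewrite ucompA.
have e : V23^* * (U34 * W24) = W24 * U34 * V23^*.
  by apply: swapV; rewrite -h2 ucompA.
rewrite [X in _ * X]ucompA !ucompA (ucomp_eq c1) -(ucompA _ W24) -(ucompA _ V23).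
rewrite h2' !ucompA -(ucompA _ S14) -(ucompA _ T13) h3' !ucompA (ucomp_eq c2).
rewrite (ucomp_eq (commV c1)) -(ucompA _ U34) -(ucompA _ V23^*) e !ucompA.
by rewrite -h1 -(ucompA _ S12 U34) c3 !ucompA.
Qed.

(** The first two factors of $Z_{24}$ cancel against $S_{23}V_{34}^{*}$, and the conjugation of
    $T_{14}$ by $S_{23}$ is trivial. *)
Lemma absorber_tens_group (S13 S23 V34 T14 T24 : unitary Q Q) :
  S23 * T14 = T14 * S23 ->
  let Z24 := V34 * S23^* * V34^* * S23 in
  S13 * S23 * V34^* * (Z24 * T14 * Z24^* * T24) * V34 =
  S13 * V34^* * T14 * V34 * (S23 * V34^* * T24 * V34).
Proof.
move=> c /=; rewrite !ustarM !ustarK !ucompA ucompKV ucompK.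
by rewrite (ucomp_eq c) ucompK.
Qed.

Lemma braid_tens_group (S13 S23 V34 Z14 : unitary Q Q) :
  Z14 * S23 = S23 * Z14 -> Z14 = V34 * S13^* * V34^* * S13 ->
  V34 * S23^* * V34^* * S23 * Z14 =
  V34 * (S13 * S23)^* * V34^* * (S13 * S23).
Proof.
move=> c e; rewrite -(ucompA _ S23) -c e ustarM !ucompA.
by rewrite ucompKV.
Qed.

End AbsorberIdentities.

(** * The braiding unitaries and the object $\rho$ *)

Section Absorber.
Context {R : realType} {H L : hilbertType R}.
Context {W : unitary (H ⊗ H) (H ⊗ H)} {U : unitary (L ⊗ H) (L ⊗ H)}.
Context {V : unitary (H ⊗ L) (H ⊗ L)} {F : unitary (L ⊗ L) (L ⊗ L)}.
Hypothesis bmu : braided_multiplicative_unitary W U V F.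

Lemma braid_unitaryP (K : hilbertType R) (S : unitary (K ⊗ H) (K ⊗ H)) :
  right_representation W S -> braid_spec V S (braid_unitary V S).
Proof.
move=> /(bmu_braid bmu) ex; rewrite /braid_unitary; case: pselect => // e.
exact: projT2 (cid e).
Qed.

(** Serves to compute the braiding with $\rho$: as $\mathcal H\ne0$, the equation for $Z_{13}$
    leaves one choice of $Z$. *)
Lemma braid_unitary_unique (K : hilbertType R) (S : unitary (K ⊗ H) (K ⊗ H)) Z :
  (exists h : H, h <> 0%R) -> braid_spec V S Z -> braid_unitary V S = Z.
Proof.
move=> h0 SZ; rewrite /braid_unitary; case: pselect => [e|]; last by case; exists Z.
apply: (place_inj (t := leg23 (flip L H))) => //.
by rewrite -!leg13_place SZ; exact: (projT2 (cid e)).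
Qed.

(** This is $V_{23}W_{12}=W_{12}V_{13}V_{23}$ solved for $V_{13}^{*}$. *)
Lemma braid_spec_W : braid_spec V W V^*.
Proof.
rewrite /braid_spec leg13V leg12V leg23V -[RHS]ucompA.
have e : V@23^* * (W@12 * V@13) = W@12 * V@23^* :> unitary (H ⊗ H ⊗ L) _.
  by apply: swapV; rewrite (bmu_corep bmu).
rewrite -[V@23^* * _](ucompK _ V@13) -(ucompA V@23^*) e !ucompA.
by rewrite ucompKV ucompV ucomp1l.
Qed.

Lemma braid_spec_on (K A : hilbertType R) (S : unitary (K ⊗ H) (K ⊗ H)) Z :
  braid_spec V S Z ->
  (on14 Z = on34 V * (on13 S)^* * (on34 V)^* * on13 S
     :> unitary (K ⊗ A ⊗ H ⊗ L) _) /\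
  (on24 Z = on34 V * (on23 S)^* * (on34 V)^* * on23 S
     :> unitary (A ⊗ K ⊗ H ⊗ L) _).
Proof.
rewrite /braid_spec leg12V leg23V => ZE.
by rewrite -on134_13 -on134_12 -on134_23 -on234_13 -on234_12 -on234_23 -!placeV
  -!placeM ZE.
Qed.

(** A hexagon identity of the braiding: [Z1] and [S2] are on disjoint legs and commute, after which
    $V_{34}^{*}V_{34}$ cancels between the two formulas. *)
Lemma braid_spec_tens (K1 K2 : hilbertType R) (S1 : unitary (K1 ⊗ H) (K1 ⊗ H))
    (S2 : unitary (K2 ⊗ H) (K2 ⊗ H)) Z1 Z2 :
  braid_spec V S1 Z1 -> braid_spec V S2 Z2 ->
  braid_spec V (S1@13 * S2@23) (Z2@23 * Z1@13).
Proof.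
move=> /(braid_spec_on K2)[h1 _] /(braid_spec_on K1)[_ h2].
rewrite /braid_spec leg12V leg23V leg13_on124 leg12_on123 leg23_on34.
rewrite placeM on124_23 on124_13 placeM on123_13 on123_23 h2.
by apply: braid_tens_group => //; exact: on14_23C.
Qed.

Lemma right_representation_tens (K1 K2 : hilbertType R)
    (S1 : unitary (K1 ⊗ H) (K1 ⊗ H)) (S2 : unitary (K2 ⊗ H) (K2 ⊗ H)) :
  right_representation W S1 -> right_representation W S2 ->
  right_representation W (S1@13 * S2@23).
Proof.
move=> h1 h2; rewrite /right_representation leg13_on124 leg12_on123 leg23_on34.
rewrite placeM on123_13 on123_23 placeM on124_13 on124_23.
have e1 : on34 W * on13 S1 = on13 S1 * on14 S1 * on34 W
    :> unitary (K1 ⊗ K2 ⊗ H ⊗ H) _.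
  by rewrite -on134_23 -on134_12 -on134_13 -!placeM h1.
have e2 : on34 W * on23 S2 = on23 S2 * on24 S2 * on34 W
    :> unitary (K1 ⊗ K2 ⊗ H ⊗ H) _.
  by rewrite -on234_23 -on234_12 -on234_13 -!placeM h2.
by rewrite ucompA e1 -(ucompA _ (on34 W)) e2 !ucompA (ucomp_eq (on14_23C _ _)).
Qed.

Lemma braiding_conj (A K : hilbertType R) (S : unitary (K ⊗ H) (K ⊗ H))
    (T : unitary (A ⊗ L) (A ⊗ L)) :
  (braiding V S)@23 * T@12 * (braiding V S)^*@23 =
  (braid_unitary V S)@23 * T@13 * (braid_unitary V S)^*@23.
Proof. exact: braid_conj. Qed.

Lemma rep_object_W : rep_object W U V F (RepData H W 1).
Proof.
split=> /=; first exact: bmu_mult bmu.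
  by rewrite leg12_1 ucomp1l ucomp1r.
by rewrite leg12_1 ucomp1l !ucomp1r leg23V ucompV ucomp1l.
Qed.

Lemma rep_object_U : rep_object W U V F (RepData L U F).
Proof. by case: bmu. Qed.

Local Notation rho := (RepData (H ⊗ L) (W@13 * U@23) F@23 : rep_data H L).

Lemma rho_tens : rho = rep_tens V (RepData H W 1) (RepData L U F).
Proof.
rewrite /rep_tens /=; congr RepData.
by rewrite leg12_1 ucomp1r leg23V ucompV ucomp1l.
Qed.

Lemma rep_object_rho : rep_object W U V F rho.
Proof.
split=> /=.
- exact: (right_representation_tens (bmu_mult bmu) (bmu_rep bmu)).
(* As $W_{14}$ commutes with $F_{23}$, the relation between $U$ and $F$ on the last three legs
   suffices. *)
- rewrite leg13_on124 leg12_on123 leg23_on34 placeM on124_23 on124_13 on123_23.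
  have e : on24 U * on34 U * on23 F = on23 F * on24 U * on34 U
      :> unitary (H ⊗ L ⊗ L ⊗ H) _.
    by rewrite -on234_12 -on234_13 -on234_23 -!placeM (bmu_F_U bmu).
  by rewrite -!(ucompA (on14 W)) e !ucompA on14_23C.
(* This is the braided pentagon equation on the last three of four legs. *)
rewrite !leg23_on34 leg12_on123 on123_23 -!on234_23 -!on234_12 -!placeM.
by rewrite (bmu_pentagon bmu).
Qed.

(* The braiding of L with itself intertwines the corepresentation of V. *)
Lemma braid_unitary_V : (exists h : H, h <> 0%R) -> let Z := braid_unitary V U in
  V@13 * V@12 * Z@23 = Z@23 * V@12 * V@13 :> unitary (H ⊗ L ⊗ L) _.
Proof.
(* A spare copy of $\mathcal H$ becomes leg 3, where the formula defining $Z$ needs it; placing is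
   injective because this copy is nonzero. *)
move=> h0 Z; apply: (place_inj (t := frame124 H L H L)) h0 _.
have [_ e] := braid_spec_on H (braid_unitaryP (bmu_rep bmu)).
rewrite placeM (placeM _ V@13) placeM (placeM _ Z@23) on124_12 on124_13 on124_23.
rewrite e; apply: (yang_baxter_group (W13 := on13 W)).
- by rewrite -on123_12 -on123_13 -on123_23 -!placeM (bmu_Drinfeld bmu).
- by rewrite -on134_12 -on134_13 -on134_23 -!placeM (bmu_corep bmu).
- exact: on12_34C.
- exact: on14_23C.
by rewrite -e on13_24C.
Qed.

End Absorber.

(** * Naturality of leg operators *)

Section Intertwine.
Context {R : realType}.

Definition intertwines (A B A' B' : hilbertType R) (f : bounded_op A A')
    (g : bounded_op B B') (X : unitary A B) (Y : unitary A' B') :=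
  bop_comp Y f = bop_comp g X.

Lemma intertwinesP (A B A' B' : hilbertType R) (f : bounded_op A A')
    (g : bounded_op B B') (X : unitary A B) (Y : unitary A' B') :
  intertwines f g X Y <-> forall v, Y (f v) = g (X v).
Proof.
split=> [e v|e]; last by apply: bounded_op_ext.
exact: (congr1 (fun h : bounded_op _ _ => h v) e).
Qed.

Lemma intertwinesM (A B C A' B' C' : hilbertType R) (f : bounded_op A A')
    (g : bounded_op B B') (h : bounded_op C C') (X : unitary A B)
    (Y : unitary A' B') (X' : unitary B C) (Y' : unitary B' C') :
  intertwines g h X' Y' -> intertwines f g X Y ->
  intertwines f h (X' * X) (Y' * Y).
Proof.
by move=> /intertwinesP e' /intertwinesP e; apply/intertwinesP => v /=; rewrite e e'.
Qed.

Lemma intertwinesV (A B A' B' : hilbertType R) (f : bounded_op A A')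
    (g : bounded_op B B') (X : unitary A B) (Y : unitary A' B') :
  intertwines f g X Y -> intertwines g f X^* Y^*.
Proof.
move=> /intertwinesP e; apply/intertwinesP => v /=.
by rewrite -{1}(uadjK X v) -e uopK.
Qed.

Lemma bop_tens_ext (A B Q : hilbertType R) (f g : bounded_op (A ⊗ B) Q) :
  (forall a b, f (tensv A B a b) = g (tensv A B a b)) -> f = g.
Proof. by move=> h; apply: total_ext (@total_pure _ A B) _ => -[a b]; exact: h. Qed.

Lemma bop_tens_unitary (A B A' B' : hilbertType R) (X : unitary A A')
    (Y : unitary B B') : bop_tens X Y = utens X Y.
Proof. by apply: bop_tens_ext => a b; rewrite bop_tensE utensE. Qed.

Variables (A A' : hilbertType R) (f : bounded_op A A').
Local Notation "f '⊗1' B" := (bop_tens f (bop_id B)) (at level 40, B at level 9).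

Lemma intertwines_utens (B B' : hilbertType R) (X : unitary B B') :
  intertwines (f ⊗1 B) (f ⊗1 B') (utens 1 X) (utens 1 X).
Proof. by apply: bop_tens_ext => a b /=; rewrite !(bop_tensE, utensE). Qed.

Lemma intertwines_assoc (B C : hilbertType R) :
  intertwines (f ⊗1 B ⊗1 C) (f ⊗1 (B ⊗ C)) (assoc A B C) (assoc A' B C).
Proof.
apply: total_ext (total_tensv (@total_pure _ A B) (@total_id _ C)) _.
by move=> [[a b] c] /=; rewrite !(bop_tensE, assocE).
Qed.

Lemma intertwines_leg12 (B C : hilbertType R) (X : unitary (A ⊗ B) (A ⊗ B))
    (Y : unitary (A' ⊗ B) (A' ⊗ B)) : intertwines (f ⊗1 B) (f ⊗1 B) X Y ->
  intertwines (f ⊗1 B ⊗1 C) (f ⊗1 B ⊗1 C) X@12 Y@12.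
Proof.
move=> /intertwinesP e; apply: bop_tens_ext => v c /=.
by rewrite !(bop_tensE, utensE) /= e.
Qed.

Lemma intertwines_leg23 (B C B' C' : hilbertType R) (X : unitary (B ⊗ C) (B' ⊗ C')) :
  intertwines (f ⊗1 B ⊗1 C) (f ⊗1 B' ⊗1 C') X@23 X@23.
Proof.
apply: intertwinesM (intertwines_assoc _ _).
apply: intertwinesM (intertwines_utens _).
exact/intertwinesV/intertwines_assoc.
Qed.

Lemma intertwines_leg13 (B C : hilbertType R) (X : unitary (A ⊗ C) (A ⊗ C))
    (Y : unitary (A' ⊗ C) (A' ⊗ C)) : intertwines (f ⊗1 C) (f ⊗1 C) X Y ->
  intertwines (f ⊗1 B ⊗1 C) (f ⊗1 B ⊗1 C) X@13 Y@13.
Proof.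
move=> e; apply: intertwinesM (intertwines_leg23 _).
by apply: intertwinesM (intertwines_leg23 _) (intertwines_leg12 _ _).
Qed.

End Intertwine.

(** * The absorber and its axioms *)

Section AbsorberArrow.
Context {R : realType} {H L : hilbertType R}.
Context {W : unitary (H ⊗ H) (H ⊗ H)} {U : unitary (L ⊗ H) (L ⊗ H)}.
Context {V : unitary (H ⊗ L) (H ⊗ L)} {F : unitary (L ⊗ L) (L ⊗ L)}.
Hypothesis bmu : braided_multiplicative_unitary W U V F.
Local Notation rho := (RepData (H ⊗ L) (W@13 * U@23) F@23 : rep_data H L).

Definition absorber3 (K : hilbertType R) (S : unitary (K ⊗ H) (K ⊗ H))
    (T : unitary (K ⊗ L) (K ⊗ L)) : unitary (K ⊗ H ⊗ L) (K ⊗ H ⊗ L) :=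
  S@12 * V^*@23 * T@13 * V@23.

(** The carrier of $x\otimes\rho$ is $K\otimes(\mathcal H\otimes\mathcal L)$, while legs are
    numbered on left-nested products. *)
Definition absorber (K : hilbertType R) (S : unitary (K ⊗ H) (K ⊗ H))
    (T : unitary (K ⊗ L) (K ⊗ L)) : unitary (K ⊗ (H ⊗ L)) (K ⊗ (H ⊗ L)) :=
  assoc K H L * absorber3 S T * (assoc K H L)^*.

(** Of the leg operators, only those of $S$ and $T$ involve the space on which [a] acts, and these
    are intertwined by hypothesis. *)
Lemma absorber_naturality (K1 K2 : hilbertType R) (a : bounded_op K1 K2) S1 S2 T1 T2 :
  intertwines (bop_tens a (bop_id H)) (bop_tens a (bop_id H)) S1 S2 ->
  intertwines (bop_tens a (bop_id L)) (bop_tens a (bop_id L)) T1 T2 ->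
  intertwines (bop_tens a (bop_id (H ⊗ L))) (bop_tens a (bop_id (H ⊗ L)))
    (absorber S1 T1) (absorber S2 T2).
Proof.
move=> eS eT; apply: intertwinesM; last exact/intertwinesV/intertwines_assoc.
apply: intertwinesM (intertwines_assoc _ _ _) _.
apply: intertwinesM (intertwines_leg23 _ _).
apply: intertwinesM (intertwines_leg13 _ eT).
apply: intertwinesM (intertwines_leg23 _ _).
exact: intertwines_leg12.
Qed.

Lemma absorber3_on123 (K D : hilbertType R) S T :
  on123 (absorber3 S T) = on12 S * (on23 V)^* * on13 T * on23 V
    :> unitary (K ⊗ H ⊗ L ⊗ D) _.
Proof. by rewrite -on123_12 -on123_13 -on123_23 -placeV -leg23V -!placeM. Qed.

Lemma absorber3_on134 (K B : hilbertType R) S T :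
  on134 (absorber3 S T) = on13 S * (on34 V)^* * on14 T * on34 V
    :> unitary (K ⊗ B ⊗ H ⊗ L) _.
Proof. by rewrite -on134_12 -on134_13 -on134_23 -placeV -leg23V -!placeM. Qed.

Lemma absorber3_on234 (K A : hilbertType R) S T :
  on234 (absorber3 S T) = on23 S * (on34 V)^* * on24 T * on34 V
    :> unitary (A ⊗ K ⊗ H ⊗ L) _.
Proof. by rewrite -on234_12 -on234_13 -on234_23 -placeV -leg23V -!placeM. Qed.

Lemma conjK (A B : hilbertType R) (u : unitary A B) X :
  u^* * (u * X * u^*) * u = X.
Proof. by rewrite !ucompA ucompVl ucomp1l ucompKV. Qed.

Lemma conj_inj (A B : hilbertType R) (u : unitary A B) X Y :
  u * X * u^* = u * Y * u^* -> X = Y.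
Proof.
by move=> e; rewrite -(conjK u X) e conjK.
Qed.

Lemma conjM (A B : hilbertType R) (u : unitary A B) (X Y : unitary A A) :
  u * (X * Y) * u^* = u * X * u^* * (u * Y * u^*).
Proof. by rewrite !ucompA ucompKV. Qed.

Lemma absorber_arrowS (K : hilbertType R) S T :
  rep_object W U V F (RepData K S T) ->
  (absorber S T)@12 * (S@13 * (W@13 * U@23)@23) =
  (W@13 * U@23)@23 * (absorber S T)@12 :> unitary (K ⊗ (H ⊗ L) ⊗ H) _.
Proof.
move=> [/= hS hU _]; apply: (conj_inj (u := regroup23)).
rewrite conjM [in RHS]conjM regroup23_leg12 conjM regroup23_leg13 regroup23_leg23.
rewrite placeM on234_13 on234_23 absorber3_on123.
apply: absorber_S_group.
- by rewrite -on124_12 -on124_13 -on124_23 -!placeM hS.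
- by rewrite -on234_12 -on234_13 -on234_23 -!placeM (bmu_Drinfeld bmu).
- by rewrite -on134_12 -on134_13 -on134_23 -!placeM hU.
- by rewrite on14_23C.
- exact: on13_24C.
- exact: on12_34C.
Qed.

Lemma absorber_arrowT (K : hilbertType R) S T : (exists h : H, h <> 0%R) ->
  rep_object W U V F (RepData K S T) ->
  let c := braiding V (W@13 * U@23) in
  (absorber S T)@12 * (c@23 * T@12 * c^*@23 * F@23@23) =
  F@23@23 * (absorber S T)@12 :> unitary (K ⊗ (H ⊗ L) ⊗ L) _.
Proof.
move=> h0 [/= _ _ hF]; rewrite braiding_conj.
set Z := braid_unitary V U.
have {}hF : F@23 * T@12 = T@12 * (Z@23 * T@13 * Z^*@23) * F@23
    :> unitary (K ⊗ L ⊗ L) _.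
  by rewrite hF -braiding_conj !ucompA.
(* The braiding with $\rho$ is assembled from those with $(\mathcal H,W)$, where the unitary is
   $V^{*}$, and with $(\mathcal L,U)$. This uses the uniqueness of $Z$, hence $\mathcal H\ne0$. *)
have -> : braid_unitary V (W@13 * U@23) = Z@23 * V^*@13.
  apply: braid_unitary_unique h0 _; apply: braid_spec_tens.
    exact: braid_spec_W bmu.
  exact: braid_unitaryP bmu _ _ (bmu_rep bmu).
apply: (conj_inj (u := regroup23)).
rewrite conjM [in RHS]conjM regroup23_leg12 !conjM regroup23_leg13.
rewrite !regroup23_leg23 leg13V !placeV placeM !on234_23 placeV on234_13.
rewrite !ustarM ustarK !ucompA absorber3_on123.
have := absorber_T_group (S12 := on12 S) (V23 := on23 V) (V24 := on24 V)
  (T13 := on13 T) (T14 := on14 T) (Z34 := on34 Z) (F34 := on34 F).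
rewrite !ucompA; apply.
- by rewrite -on234_12 -on234_13 -on234_23 -!placeM (bmu_F_V bmu).
- by rewrite -on234_12 -on234_13 -(on234_23 Z) -!placeM (braid_unitary_V bmu h0).
- rewrite -on134_12 -on134_13 -!on134_23 -placeV -leg23V -!placeM hF.
  by rewrite !ucompA.
- by rewrite on14_23C.
- exact: on13_24C.
- exact: on12_34C.
Qed.

Lemma absorber_tensor (K1 K2 : hilbertType R) S1 S2 T1 T2 :
  right_representation W S2 ->
  let c := braiding V S2 in
  absorber (S1@13 * S2@23) (c@23 * T1@12 * c^*@23 * T2@23) =
  (absorber S1 T1)@13 * (absorber S2 T2)@23 :> unitary (K1 ⊗ K2 ⊗ (H ⊗ L)) _.
Proof.
move=> hS2; have [_ e] := braid_spec_on K1 (braid_unitaryP bmu hS2).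
apply: (conj_inj (u := regroup34)); rewrite conjM.
rewrite regroup34_leg13 regroup34_leg23 absorber3_on134 absorber3_on234.
have := absorber_tens_group (on13 S1) (on34 V) (on24 T2) (esym (on14_23C T1 S2)).
rewrite /= -e => <-; rewrite braiding_conj leg23V.
rewrite /absorber /regroup34 ustarK conjK.
rewrite /absorber3 leg23V leg12_on123 leg13_on124 !leg23_on34.
rewrite placeM on123_13 on123_23 3!placeM placeV on124_13 !on124_23.
by rewrite !ucompA.
Qed.

Lemma rep_arrow_unitary (x y : rep_data H L) (X : unitary x y) :
  utens X 1 * rep_S x = rep_S y * utens X 1 ->
  utens X 1 * rep_T x = rep_T y * utens X 1 ->
  rep_arrow X.
Proof.
move=> /(congr1 (@uop _ _ _)) eS /(congr1 (@uop _ _ _)) eT.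
by split; rewrite -[bop_id _]/(uop 1) bop_tens_unitary.
Qed.

Lemma zero_space_ext (K M Q : hilbertType R) (f g : bounded_op (K ⊗ (H ⊗ L) ⊗ M) Q) :
  (forall h : H, h = 0%R) -> f = g.
Proof.
move=> H0; apply: total_ext (total_tensv (total_tensv (@total_id _ K)
  (@total_pure _ H L)) (@total_id _ M)) _.
move=> [[k [h l]] m] /=.
by rewrite (H0 h) linear0l linear0r linear0l !GRing.linear0.
Qed.

Lemma absorber_rep_arrow (x : rep_data H L) : rep_object W U V F x ->
  @rep_arrow R H L (rep_tens V x rho) (rep_tens V (rep_trivial H L x) rho)
    (absorber (rep_S x) (rep_T x)).
Proof.
case: x => K S T x_obj.
have [h0|H0] := pselect (exists h : H, h <> 0%R); last first.
  have {}H0 h : h = 0%R :> H.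
    by apply: contrapT => hn0; apply: H0; exists h.
  by split; exact: zero_space_ext.
apply: rep_arrow_unitary => /=.
  (* The trivial object contributes an identity, so the target carries the $S$-part of $\rho$ on
     legs 2 and 3. *)
  by rewrite leg13_1 ucomp1l; exact: absorber_arrowS.
(* Around the trivial $T$ the braiding cancels, which leaves $F$. *)
rewrite leg12_1 ucomp1r leg23V ucompV ucomp1l -leg23V.
exact: absorber_arrowT.
Qed.

End AbsorberArrow.

Theorem proposition3p3 (R : realType) (H L : hilbertType R)
    (W : unitary (H ⊗ H) (H ⊗ H)) (U : unitary (L ⊗ H) (L ⊗ H))
    (V : unitary (H ⊗ L) (H ⊗ L)) (F : unitary (L ⊗ L) (L ⊗ L)) :
  braided_multiplicative_unitary W U V F ->
  let rho : rep_data H L := RepData (H ⊗ L) (W@13 * U@23) F@23 in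
  [/\ rep_object W U V F (RepData H W 1),
      rep_object W U V F (RepData L U F),
      rho = rep_tens V (RepData H W 1) (RepData L U F) &
      exists A : forall x : rep_data H L, unitary (x ⊗ rho) (rep_trivial H L x ⊗ rho),
        natural_right_absorber W U V F A].
Proof.
move=> bmu rho; split.
- exact: rep_object_W.
- exact: rep_object_U.
- exact: rho_tens.
exists (fun x => absorber (V := V) (rep_S x) (rep_T x)); split.
- exact: rep_object_rho.
- by move=> x; exact: absorber_rep_arrow.
- by move=> x1 x2 a _ _ [aS aT]; apply: absorber_naturality.
by move=> [K1 S1 T1] [K2 S2 T2] _ [hS2 _ _]; exact: (absorber_tensor bmu).
Qed.
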